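(* Let $t,r,d_1,\dots,d_r,e$ be positive integers. Set $d_j=2$ for $r<j\le r+e$ and $m=\max\{d_i\}_{1\le i\le r+e}$. Assume $$\frac{(t+2)(t+1)}{2}\ \ge\ 1+\sum_{1\le j\le r+e}\frac{d_j(d_j+1)}{2}\qquad\text{and}\qquad e\ \ge\ \frac{(m-1)(t-1)}{2}.$$ Then for a general multi-jet $Z=\bigcup_{1\le j\le r+e}d_jP_j$ of type $(r+e;d_1,\dots,d_{r+e})$ in $\mathbf{P}^2$ we have $h^1(\mathbf{P}^2,\mathbf{I}_Z(t))=0$.
   Context: The base field is algebraically closed of characteristic $0$. For a point $P$ of a smooth surface $X$ and an integer $d>0$, $dP$ denotes the fat point of multiplicity $d$ supported at $P$, i.e. the $0$-dimensional subscheme of $X$ with ideal sheaf $(\mathbf{I}_{P,X})^d$ (the $(d-1)$-th infinitesimal neighbourhood of $P$ in $X$); its length is $d(d+1)/2$. A multi-jet of type $(s;m_1,\dots,m_s)$ on $X$ (with $s,m_1,\dots,m_s$ positive integers) is a $0$-dimensional subscheme $\bigcup_{1\le i\le s}m_iP_i$ with $P_1,\dots,P_s$ distinct points of $X$. The multi-jets of a fixed type on $X$ form an integral variety of dimension $2s$; ''for a general multi-jet'' means for all multi-jets in a non-empty Zariski open subset of this variety (equivalently, for $(P_1,\dots,P_s)$ in a non-empty open subset of $X^s$). $\mathbf{I}_Z$ is the ideal sheaf of $Z$ and $\mathbf{I}_Z(t)=\mathbf{I}_Z\otimes\mathcal{O}_{\mathbf{P}^2}(t)$. *)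

(* Defs.v *)
From HB Require Import structures.
From mathcomp Require Import all_boot all_order all_algebra.
From mathcomp Require Import fraction.
From mathcomp.multinomials Require Import freeg mpoly.

Set Implicit Arguments.
Unset Strict Implicit.
Unset Printing Implicit Defensive.

Import GRing.Theory.
Local Open Scope ring_scope.

Section Ideals.
Variable R : comNzRingType.
Implicit Types (S I : R -> Prop) (x : R).

Definition ideal_gen S x : Prop :=
  exists2 s : seq (R * R),
    (forall y, y \in s -> S y.2) & x = \sum_(y <- s) y.1 * y.2.

Definition ideal_pow I (d : nat) : R -> Prop :=
  ideal_gen (fun x => exists2 u : d.-tuple R,
    (forall i, I (tnth u i)) & x = \prod_(i < d) tnth u i).

End Ideals.

Section Plane.
Variable F : closedFieldType.

(* A point of P^2 is the row space of a non-zero row vector of homogeneous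
   coordinates; a matrix with n non-zero rows encodes an n-tuple of points,
   row i giving the i-th one. *)
Definition is_points n (P : 'M[F]_(n, 3)) : Prop :=
  forall i, row i P != 0.

Definition distinct_points n (P : 'M[F]_(n, 3)) : Prop :=
  forall i j, i != j -> ~~ (row i P == row j P)%MS.

(* Zariski topology of (P^2)^n: the closed sets are the zero loci of sets of
   multihomogeneous polynomials in n groups of 3 variables; the variable with
   index mxvec_index i j is the j-th homogeneous coordinate of the i-th
   point. *)
Definition multihomog n (f : {mpoly F[n * 3]}) : Prop :=
  exists a : 'I_n -> nat, forall m, m \in msupp f ->
    forall i, (\sum_(j < 3) m (mxvec_index i j))%N = a i.

Definition eval_points n (f : {mpoly F[n * 3]}) (P : 'M[F]_(n, 3)) : F :=
  f.@[fun k => mxvec P 0 k].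

Definition zariski_open n (U : 'M[F]_(n, 3) -> Prop) : Prop :=
  exists2 S : {mpoly F[n * 3]} -> Prop,
    (forall f, S f -> multihomog f) &
    (forall P, is_points P ->
       (U P <-> exists2 f, S f & eval_points f P != 0)).

Definition for_general_points n (A : 'M[F]_(n, 3) -> Prop) : Prop :=
  exists U : 'M[F]_(n, 3) -> Prop,
    [/\ zariski_open U,
        (exists2 P, is_points P & U P) &
        (forall P, is_points P -> U P -> A P)].

Local Notation S := {mpoly F[3]}.

Definition point_ideal (v : 'rV[F]_3) : S -> Prop :=
  ideal_gen (fun f =>
    (exists k, f \is k.-homog) /\ f.@[fun j => v 0 j] = 0).

(* The homogeneous ideal of the union of the fat points d_i P_i. *)
Definition fat_ideal n (d : 'I_n -> nat) (P : 'M[F]_(n, 3)) : S -> Prop :=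
  fun f => forall i, ideal_pow (point_ideal (row i P)) (d i) f.

(* For a homogeneous ideal I with associated ideal sheaf I~ and a homogeneous
   g of degree c, the sections of I~(t) over D_+(g) form the degree t part of
   the localization I_g. All of these groups are viewed inside the fraction
   field of F[x_0, x_1, x_2], where restriction maps become inclusions. *)
Definition section (I : S -> Prop) (t c : nat) (g : S)
    (phi : {fraction S}) : Prop :=
  exists k, exists f : S,
    [/\ I f, f \is (t + k * c).-homog & phi = tofrac f / tofrac g ^+ k].

(* H^1(P^2, I~(t)) is the first Cech cohomology group of I~(t) for the affine
   open cover of P^2 by the D_+(x_i): the group of 1-cocycles modulo that of
   1-coboundaries. *)
Definition cocycle1 (I : S -> Prop) (t : nat)
    (s : 'I_3 -> 'I_3 -> {fraction S}) : Prop :=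
  (forall i j, section I t 2 ('X_i * 'X_j) (s i j)) /\
  (forall i j k, s j k - s i k + s i j = 0).

Definition coboundary1 (I : S -> Prop) (t : nat)
    (s : 'I_3 -> 'I_3 -> {fraction S}) : Prop :=
  exists2 u : 'I_3 -> {fraction S},
    (forall i, section I t 1 'X_i (u i)) &
    (forall i j, s i j = u j - u i).

Definition h1_eq0 (I : S -> Prop) (t : nat) : Prop :=
  forall s, cocycle1 I t s -> coboundary1 I t s.

End Plane.

Definition mult_seq r e (d : 'I_r -> nat) (j : 'I_(r + e)) : nat :=
  match split j with inl i => d i | inr _ => 2 end.
Arguments mult_seq {r} e d j.

(* Main.v *)
(** A form of degree t is a combination of the lattice points (i, j) with
   i + j <= t.  Let one of the points tend to the boundary of the torus along
   (T^-1 : T^K : 1): in the limit a d-fold point kills exactly the d(d+1)/2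
   lattice points of least weight that no curve of degree < d contains, and
   the other points see only the lattice points that are left.  So the fat
   points impose independent conditions as soon as the lattice triangle can be
   packed by such sets, one after the other.

   The packing proceeds row by row.  A d-fold point takes d, d - 1, ..., 1
   lattice points from consecutive rows, starting in the first row that is not
   yet used up, or 1, d, d - 1, ..., 2 when only one lattice point is left in
   that row.  The points with d > 2 go first; when the next of them does not
   fit, double points fill the rest of the row.  This takes on average at most
   (m - 1)/2 double points per row, which is where the bound on e comes from.

   Independence is an open condition.  It yields h^1 = 0, because h^1(O(t)) = 0
   and forms of degree t then realise all jets at the fat points. *)

Require Import Defs.
From mathcomp Require Import all_boot all_order all_algebra.
From mathcomp Require Import fraction zify ring.
From mathcomp.multinomials Require Import freeg mpoly.
Set Implicit Arguments.
Unset Strict Implicit.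
Unset Printing Implicit Defensive.
Import GRing.Theory.

(** * Packing the lattice triangle *)

(* [n k] counts the lattice points [(i, k)], [i < n k], of row [k] that are
   still free; the list gives the multiplicities in the order of removal, and
   points are always removed from the right end of a row. *)
Inductive fillable : (nat -> nat) -> seq nat -> Prop :=
| FillNil n : fillable n [::]
| FillFlat (n n' : nat -> nat) s d ds of
    (forall k, k < s -> n k = 0) &
    (forall k, k < d -> d - k <= n (s + k)) &
    (forall k, n' k = n k - (if s <= k then d - (k - s) else 0)) &
    fillable n' ds : fillable n (d :: ds)
| FillTip (n n' : nat -> nat) s d ds of
    (forall k, k < s -> n k = 0) & n s = 1 &
    (forall k, k.+1 < d -> d - k <= n (s.+1 + k)) &
    (forall k, n' k = n k - (if k <= s then (k == s :> nat) : nat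
                             else if k < s + d then d - (k - s.+1) else 0)) &
    fillable n' ds : fillable n (d :: ds).

Definition tri d := (d * (d + 1)) %/ 2.

Lemma double_tri d : 2 * tri d = d * (d + 1).
Proof.
rewrite /tri mulnC divnK // dvdn2 oddM oddD /=.
by case: (odd d).
Qed.

Lemma triS d : tri d.+1 = d.+1 + tri d.
Proof. by have := double_tri d; have := double_tri d.+1; nia. Qed.

(** The second summand is the part of the pattern in rows from [N] on, so the identity holds
    wherever [N] cuts the pattern. *)
Lemma sum_flat N s d :
  \sum_(k < N) (if s <= k then d - (k - s) else 0) + tri (d - (N - s)) = tri d.
Proof.
elim: N => [|N IH]; first by rewrite big_ord0 sub0n subn0.
rewrite big_ord_recr /= -[RHS]IH -addnA; congr (_ + _).
case: leqP => h; last by rewrite add0n; congr tri; lia.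
case E: (d - (N - s)) => [|x]; first by rewrite (_ : d - (N.+1 - s) = 0) //; lia.
by rewrite triS; congr (_ + tri _); lia.
Qed.

(** Row [s] takes one point and the rows after it take [d, ..., 2]. Past row [s] the part still to
    come is thus a triangle without its last point, hence the predecessor. *)
Lemma sum_tip N s d : 0 < d ->
  \sum_(k < N) (if k <= s then (k == s :> nat) : nat
                else if k < s + d then d - (k - s.+1) else 0)
  + (if N <= s then tri d else (tri (d - (N - s.+1))).-1) = tri d.
Proof.
move=> d0; elim: N => [|N IH]; first by rewrite big_ord0.
rewrite big_ord_recr /= -[RHS]IH -addnA; congr (_ + _).
case: (ltngtP N s) => h.
- by rewrite add0n.
- case: leqP => h2.
    rewrite (_ : d - (N.+1 - s.+1) = 0); last lia.
    case E: (d - (N - s.+1)) => [|[|x]] //; lia.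
  case E: (d - (N - s.+1)) => [|[|x]]; [lia|lia|].
  rewrite (_ : d - (N.+1 - s.+1) = x.+1); last lia.
  by rewrite !triS; lia.
- subst N; rewrite subnn subn0.
  by case: d d0 {IH} => // d _; rewrite triS; lia.
Qed.

Definition room t (c : nat -> nat) k := t.+1 - k - c k.
Definition area t c := \sum_(k < t.+1) room t c k.

(* [c k] lattice points of row [k] are used. By [steady_slope] the usage drops
   from row to row by at least [1/m] of its value, so that a point fits into the
   later rows as soon as it fits into row [s]; [steady_end] excludes a column of
   single free points in the corner of the triangle, which no double point could
   use because its three points would be collinear. *)
Record steady t m s (c : nat -> nat) : Prop := Steady {
  steady_le k : c k <= t.+1 - k;
  steady_full k : k < s -> c k = t.+1 - k;
  steady_slope k : s <= k -> m * c k.+1 <= (m - 1) * c k;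
  steady_end k : s <= k -> t <= k + m -> 2 * c k.+1 <= c k }.

(** A simple point may take the last free point of the lowest row that has one, so counting
    suffices. *)
Lemma fill_singles q N (n : nat -> nat) : q <= \sum_(k < N) n k -> fillable n (nseq q 1).
Proof.
elim: q n => [|q IH] n; first by constructor.
move=> hq; have ex : exists s, 0 < n s.
  case: (boolP [exists k : 'I_N, 0 < n k]) => [/existsP[k hk]|]; first by exists k.
  rewrite negb_exists => /forallP h; suff e : \sum_(k < N) n k = 0 by lia.
  by apply: big1 => i _; have := h i; lia.
case: (ex_minnP ex) => s hs mins.
have zs k : k < s -> n k = 0 by move=> hk; have := mins k; lia.
apply: (@FillFlat n (fun k => n k - (if s <= k then 1 - (k - s) else 0)) s) => //.
  by move=> k; rewrite ltnS leqn0 => /eqP ->; rewrite addn0; lia.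
apply: IH; have tri1 : tri 1 = 1 by []; have := sum_flat N s 1; rewrite tri1 => e.
have : \sum_(k < N) n k <= \sum_(k < N) (n k - (if s <= k then 1 - (k - s) else 0))
   + \sum_(k < N) (if s <= k then 1 - (k - s) else 0).
  by rewrite -big_split /= leq_sum // => i _; lia.
lia.
Qed.

Section Moves.
Variables (t m s : nat) (c : nat -> nat).
Hypothesis (St : steady t m s c).

Let cle := steady_le St.
Let cfull := steady_full St.
Let cslope := steady_slope St.
Let cend := steady_end St.

Lemma steady_dec k : 0 < m -> s <= k -> c k.+1 <= c k.
Proof. by move=> m0 /cslope; nia. Qed.

Lemma room_dec k : 0 < m -> s <= k -> room t c k <= (room t c k.+1).+1.
Proof. by move=> m0 /(steady_dec m0); rewrite /room; lia. Qed.

(** The full row shrinks by one and the usage does not grow. Hence [d, d - 1, ..., 1] fits as soon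
    as [d] fits into the first row. *)
Lemma room_decn j k : 0 < m -> s <= k -> room t c k - j <= room t c (k + j).
Proof.
move=> m0 sk; elim: j => [|j IH]; first by rewrite subn0 addn0.
have := room_dec m0 (leq_trans sk (leq_addr j k)); rewrite addnS; lia.
Qed.

Lemma steady_room0 k : k < s -> room t c k = 0.
Proof. by move=> h; rewrite /room (cfull h); lia. Qed.

Lemma steady_next : room t c s = 0 -> steady t m s.+1 c.
Proof.
move=> e; split=> //.
- move=> k; rewrite ltnS leq_eqVlt => /orP[/eqP ->|]; last exact: cfull.
  by have := cle s; move: e; rewrite /room; lia.
- by move=> k h; apply: cslope; lia.
- by move=> k h; apply: cend; lia.
Qed.

Lemma fill_flat d : 0 < d <= m -> d <= room t c s ->
    (d <= 2) || (2 * m <= t.+1 - s) ->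
  exists c', [/\ steady t m s c', area t c <= area t c' + tri d,
    room t c' s = room t c s - d &
    forall ds, fillable (room t c') ds -> fillable (room t c) (d :: ds)].
Proof.
move=> /andP[d0 dm] dn hd.
pose c' k := c k + (if s <= k then d - (k - s) else 0); exists c'.
have fit k : k < d -> d - k <= room t c (s + k).
  by move=> kd; have := @room_decn k s; lia.
split.
- split.
  + move=> k; rewrite /c'; case: (leqP s k) => sk; last by rewrite addn0.
    have := cle k.
    case: (ltnP (k - s) d) => h; last by lia.
    by have := fit _ h; rewrite subnKC // /room; lia.
  + by move=> k ks; rewrite /c' leqNgt ks /= addn0 cfull.
  (* The pattern falls from [y] to [y - 1], and [m * (y - 1) <= (m - 1) * y] amounts to [y <= m]. *)
  + move=> k sk; rewrite /c' sk (leqW sk) !mulnDr; apply: leq_add; first exact: cslope.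
    by rewrite subSn //; nia.
  (* Here [y <= 2] is needed. If [d > 2], there are [2 * m] rows left, and the pattern has at most
     one point in a row with [t <= k + m]. *)
  + move=> k sk tk; rewrite /c' sk (leqW sk) !mulnDr; apply: leq_add; first exact: cend.
    by rewrite subSn //; lia.
- have := sum_flat t.+1 s d.
  suff : area t c <= area t c' + \sum_(k < t.+1) (if s <= k then d - (k - s) else 0) by lia.
  by rewrite /area -big_split /= leq_sum // => i _; rewrite /room /c'; lia.
- by rewrite /room /c' leqnn subnn; lia.
- move=> ds; apply: (@FillFlat _ _ s) => // k; first exact: steady_room0.
  by rewrite /room /c' subnDA.
Qed.

(** The pattern rises from [1] to [d], which may break the slope, so the steady range restarts at
    row [s.+1]; row [s] is full by then. *)
Lemma fill_tip d : 1 < d <= m -> room t c s = 1 -> d <= room t c s.+1 ->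
    (d <= 2) || (2 * m <= t.+1 - s) ->
  exists c', [/\ steady t m s.+1 c', area t c <= area t c' + tri d,
    room t c' s.+1 = room t c s.+1 - d &
    forall ds, fillable (room t c') ds -> fillable (room t c) (d :: ds)].
Proof.
move=> /andP[d0 dm] n1 dn hd.
pose c' k := c k + (if k <= s then (k == s :> nat) : nat
                    else if k < s + d then d - (k - s.+1) else 0); exists c'.
have fit k : k < d -> d - k <= room t c (s.+1 + k).
  by move=> kd; have := @room_decn k s.+1; lia.
split.
- split.
  + move=> k; rewrite /c'; have := cle k.
    case: (ltngtP k s) => sk; first by rewrite addn0.
      case: leqP => h; first lia.
      have := @fit (k - s.+1); rewrite subnKC // /room; lia.
    by subst k; move: n1; rewrite /room; lia.
  + move=> k; rewrite ltnS leq_eqVlt => /orP[/eqP ->|ks].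
      by rewrite /c' leqnn eqxx; have := cle s; move: n1; rewrite /room; lia.
    by rewrite /c' (ltnW ks) cfull //; lia.
  + move=> k sk; rewrite /c' !mulnDr; apply: leq_add; first by apply: cslope; lia.
    have [-> ->] : (k.+1 <= s = false) /\ (k <= s = false) by lia.
    case: (ltnP k.+1 (s + d)) => h; last by rewrite muln0.
    by rewrite ifT; [nia|lia].
  + move=> k sk tk; rewrite /c' !mulnDr; apply: leq_add; first by apply: cend; lia.
    have [-> ->] : (k.+1 <= s = false) /\ (k <= s = false) by lia.
    case: (ltnP k.+1 (s + d)) => h; last by rewrite muln0.
    by rewrite ifT; lia.
- have := @sum_tip t.+1 s d (ltnW d0).
  suff : area t c <= area t c' + \sum_(k < t.+1) (if k <= s then (k == s :> nat) : nat
                else if k < s + d then d - (k - s.+1) else 0) by lia.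
  by rewrite /area -big_split /= leq_sum // => i _; rewrite /room /c'; lia.
- by rewrite /room /c' ltnn ifT; lia.
- move=> ds; apply: (@FillTip _ _ s) => // k; first exact: steady_room0.
    by move=> kd; apply: fit; lia.
  by rewrite /room /c' subnDA.
Qed.

(** Rows before [s] are full, and rows from [u] on have at most their whole length free. *)
Lemma area_le u : s <= u ->
  area t c <= \sum_(s <= k < u) room t c k + tri (t.+1 - u).
Proof.
move=> su.
have h0 N : \sum_(k < N) room t c k <= \sum_(s <= k < u) room t c k +
    \sum_(k < N) (if u <= k then t.+1 - u - (k - u) else 0).
  elim: N => [|N IH]; first by rewrite big_ord0.
  case: (leqP u N) => h.
    rewrite !big_ord_recr /= h; have : room t c N <= t.+1 - N by rewrite /room; lia.
    by move=> h1; rewrite addnA; apply: leq_add => //; lia.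
  rewrite [X in _ + X]big1 ?addn0; last by move=> i _; case: leqP => // ui; have := ltn_ord i; lia.
  rewrite -(big_mkord xpredT (room t c)) /=.
  case: (leqP s N) => sN.
    rewrite (big_cat_nat (n := s)) //=; last by lia.
    rewrite big1_seq ?add0n; last first.
      by move=> i; rewrite mem_index_iota => /andP[_ hi]; apply: steady_room0.
    by rewrite [leqRHS](big_cat_nat (n := N.+1)) //= ?leq_addr //; lia.
  rewrite big1_seq // => i; rewrite mem_index_iota => /andP[_ hi]; apply: steady_room0; lia.
have := sum_flat t.+1 u (t.+1 - u); have := h0 t.+1; rewrite /area; lia.
Qed.

Lemma area_le1 : 2 * area t c <= 2 * room t c s + (t.+1 - s) * (t - s).
Proof.
have := area_le (leqnSn s); rewrite big_nat1 => h.
have := double_tri (t.+1 - s.+1); nia.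
Qed.

Lemma area_le2 : area t c <= room t c s + room t c s.+1 + tri (t.+1 - s.+2).
Proof. by have := area_le (leqW (leqnSn s)); rewrite big_nat_recr //= big_nat1. Qed.

End Moves.

Lemma steady_area0 t m s c : steady t m s c -> t < s -> area t c = 0.
Proof.
move=> St ts; apply: big1 => i _; apply: (steady_room0 St).
by have := ltn_ord i; lia.
Qed.

(** Double points go in flat, or as a tip when one point is left in the row. The extra [1] in the
    bound rules out that the last three free points are collinear and block a double point. *)
Lemma fill_doubles t m s c E q : 1 < m -> steady t m s c ->
  1 + 3 * E + q <= area t c -> fillable (room t c) (nseq E 2 ++ nseq q 1).
Proof.
move=> m1; have [w] := ubnP (E + (t.+1 - s)); elim: w E s c => // w IH E s c.
case: E => [|E] hw St ha; first by apply: (@fill_singles _ t.+1); rewrite -/(area _ _); lia.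
have st : s <= t by case: (leqP s t) => // /(steady_area0 St); lia.
have tri2 : tri 2 = 3 by [].
case en : (room t c s) => [|[|x]].
- by apply: (IH E.+1 s.+1 c) => //; [lia | exact: steady_next].
- case: (leqP 2 (room t c s.+1)) => n1.
    have [||c' [St' ha' _ f]] := @fill_tip _ _ _ _ St 2 _ en n1; try lia.
    by apply/f/(IH E s.+1) => //; lia.
  (* Both rows have at most one free point, so [steady_slope] gives [t - s <= m] and then
     [steady_end] gives [t - s <= 2]. At most three points are free, fewer than the area
     requires. *)
  have := steady_slope St (leqnn s); have := steady_end St (leqnn s).
  have := area_le2 St; have := steady_le St s; have := steady_le St s.+1.
  rewrite en; move: en n1; rewrite /room => en n1 l1 l2 ar en1 sl.
  have : c s.+1 <= c s by nia.
  have [k hk] : exists k, t.+1 - s.+2 = k by eexists.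
  move: (double_tri k); move: ar; rewrite hk.
  case: (leqP (room t c s.+1) 0); rewrite /room => n10; nia.
- have [|||c' [St' ha' _ f]] := @fill_flat _ _ _ _ St 2; try lia.
  by apply/f/(IH E s) => //; lia.
Qed.

(* The fourth hypothesis is a credit invariant: the double points left suffice
   to fill at most [m - 1] points in each row but the last two. *)
Lemma fill_all t m s c bs E q :
    1 < m -> steady t m s c -> all (fun d => 2 < d <= m) bs ->
    (m - 1) * (t - 1) + minn (room t c s) (m - 1) <= 2 * E + (m - 1) * s.+1 ->
    1 + sumn (map tri bs) + 3 * E + q <= area t c ->
  exists2 ds, perm_eq ds (bs ++ nseq E 2 ++ nseq q 1) & fillable (room t c) ds.
Proof.
move=> m1; have [w] := ubnP (size bs + E + (t.+1 - s)); elim: w bs E s c => // w IH bs E s c.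
case: bs => [|d bs] hw St hbs hE ha.
  exists (nseq E 2 ++ nseq q 1); first exact: perm_refl.
  by apply: (fill_doubles m1 St); move: ha => /=; lia.
have st : s <= t by case: (leqP s t) => // /(steady_area0 St); lia.
move: (hbs) => /= /andP[/andP[d2 dm] hbs'].
have tri2 : tri 2 = 3 by [].
have trid : 6 <= tri d by have := double_tri d; nia.
have nL : room t c s <= t.+1 - s by rewrite /room; lia.
have L2m : 2 * m <= t.+1 - s.
  (* Otherwise the points left need more room than there is: the difference is
     a convex function of the row length [l], negative at [l = 3] and at
     [l = 2m - 1]. *)
  rewrite leqNgt; apply/negP => Lm.
  have := area_le1 St; have [l Ll] : exists l, l = t.+1 - s by eexists.
  rewrite -Ll in nL Lm *; rewrite (_ : t - s = l.-1); last lia.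
  move: ha => /= ha hA; case: (leqP l 3) => l3; first by nia.
  have [a am] : exists a, m = a.+1 by exists m.-1; lia.
  have [y ly] : exists y, l = y + 3 by exists (l - 3); lia.
  have e1 : a * (t - 1) = a * s.+1 + a * y by rewrite -mulnDr; congr (_ * _); lia.
  have a2 : 2 <= a by lia.
  (* This is the convexity: [y * (y + 2 - 2 * a)] is at most [0] between its roots [0] and
     [2 * a - 2]. *)
  have hy : y * y + 2 * y <= 2 * (a * y).
    have : y + 2 <= 2 * a by lia.
    by rewrite -(leq_pmul2r (m := y)) ?mulnDl -?mulnA //; lia.
  have e2 : l * l.-1 = y * y + 5 * y + 6 by rewrite ly addn3 /=; lia.
  move: hA; rewrite e2 => hA.
  have {ha hA} : 14 + 6 * E <= 2 * room t c s + (y * y + 5 * y + 6) by lia.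
  have am1 : (m - 1) = a by lia.
  move: hE; rewrite am1 e1 => hE hA.
  have ay i : i <= a -> i * y <= a * y by move=> ia; rewrite leq_mul2r ia orbT.
  have hE' : 14 + 3 * (a * y + minn (room t c s) a) <= 2 * room t c s + (y * y + 5 * y + 6).
    lia.
  have [a3|a3] := ltnP a 5; last by have := ay 5 a3; lia.
  by move: a3 a2 hE' hy am ly nL; clear -l3 Lm; case: a => [|[|[|[|[|]]]]] //; lia.
(* Otherwise [steady_slope] would give [t - s <= m], against [L2m]. *)
have n1 : room t c s = 1 -> 2 <= room t c s.+1.
  have := steady_slope St (leqnn s).
  have := steady_le St s; have := steady_le St s.+1.
  by rewrite /room => *; nia.
have take_double ds : 0 < E -> perm_eq ds ((d :: bs) ++ nseq E.-1 2 ++ nseq q 1) ->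
    perm_eq (2 :: ds) ((d :: bs) ++ nseq E 2 ++ nseq q 1).
  case: E {hE ha hw} => // E' _ p; rewrite perm_sym (perm_catCA (d :: bs) [:: 2]) perm_sym.
  by rewrite perm_cons.
case: (leqP d (room t c s)) => nd.
  have [|||c' [St' ha' rs f]] := @fill_flat _ _ _ _ St d; try lia.
  have [|||ds p fl] := IH bs E s c' _ St' hbs'; try by move: hw ha; rewrite /=; lia.
  by exists (d :: ds); [rewrite /= perm_cons | exact: f].
case en: (room t c s) => [|[|x]].
- by apply: (IH (d :: bs) E s.+1 c) => //; [lia | exact: steady_next | nia].
- case: (leqP d (room t c s.+1)) => nd1.
    have [||c' [St' ha' rs f]] := @fill_tip _ _ _ _ St d _ en nd1; try lia.
    have [|||ds p fl] := IH bs E s.+1 c' _ St' hbs'; try by move: hw ha; rewrite /=; nia.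
    by exists (d :: ds); [rewrite /= perm_cons | exact: f].
  (* The next row has fewer than [d <= m] free points and loses two of them, so the credit [m - 1]
     gained with that row also pays for the double point. *)
  have E0 : 0 < E by nia.
  have [|||c' [St' ha' rs f]] := @fill_tip _ _ _ _ St 2 _ en; try lia.
  have [|||ds p fl] := IH (d :: bs) E.-1 s.+1 c' _ St' hbs; try by move: hw ha; rewrite /=; nia.
  by exists (2 :: ds); [exact: take_double | exact: f].
(* Fewer than [d <= m] points are left, so [minn] is the room itself; a double point lowers it by
   two, exactly its cost in [2 * E]. *)
- have E0 : 0 < E by nia.
  have [|||c' [St' ha' rs f]] := @fill_flat _ _ _ _ St 2; try lia.
  have [|||ds p fl] := IH (d :: bs) E.-1 s c' _ St' hbs; try by move: hw ha; rewrite /=; nia.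
  by exists (2 :: ds); [exact: take_double | exact: f].
Qed.

Local Open Scope ring_scope.

(** * Independent rows and degeneration *)

Section Indep.
Variables (F : fieldType) (Rw Cl : finType) (Pr : pred Rw).
Implicit Types A M : Rw -> Cl -> F.

Definition indep A := forall w : Rw -> F,
  (forall c, \sum_(r | Pr r) w r * A r c = 0) -> forall r, Pr r -> w r = 0.

Definition mx_of_rows A :=
  \matrix_(i < #|Pr|, j < #|Cl|) A (enum_val i) (enum_val j).

Lemma sum_enum_val (V : nmodType) (g : Rw -> V) :
  \sum_(r | Pr r) g r = \sum_(i < #|Pr|) g (enum_val i).
Proof. by rewrite -(big_enum_val g); apply: eq_bigl => r; rewrite unfold_in. Qed.

Lemma indepP A : indep A <-> row_free (mx_of_rows A).
Proof.
split=> [iA | fA w wA r Pr_r].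
  apply: inj_row_free => v vA; pose w r := \sum_i v 0 i * (enum_val i == r)%:R.
  have wE i : w (enum_val i) = v 0 i.
    rewrite /w (bigD1 i) //= eqxx mulr1 big1 ?addr0 // => j ji.
    by rewrite (inj_eq enum_val_inj) (negPf ji) mulr0.
  apply/rowP => i; rewrite mxE -wE; apply: iA; last exact: enum_valP.
  move=> c; rewrite sum_enum_val.
  move/rowP: vA => /(_ (enum_rank c)); rewrite !mxE => vAc; rewrite -[RHS]vAc.
  by apply: eq_bigr => j _; rewrite wE !mxE enum_rankK.
have /eqP : (\row_i w (enum_val i)) *m mx_of_rows A = 0.
  apply/rowP => j; rewrite !mxE -[RHS](wA (enum_val j)).
  rewrite sum_enum_val.
  by apply: eq_bigr => i _; rewrite !mxE.
rewrite mulmx_free_eq0 // => /eqP/rowP/(_ (enum_rank_in Pr_r r)).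
by rewrite !mxE enum_rankK_in.
Qed.

(** The product [G M] has rank at most that of [M]. *)
Lemma indep_mull A M (G : Rw -> Rw -> F) :
    (forall r c, Pr r -> A r c = \sum_(r' | Pr r') G r r' * M r' c) ->
  indep A -> indep M.
Proof.
move=> AE /indepP; rewrite -!row_leq_rank => rA; apply/indepP.
rewrite -row_leq_rank (leq_trans rA) //.
rewrite (_ : mx_of_rows A =
  (\matrix_(i < #|Pr|, j < #|Pr|) G (enum_val i) (enum_val j)) *m mx_of_rows M).
  exact: mxrankM_maxr.
apply/matrixP => i j; rewrite !mxE AE; last exact: enum_valP.
rewrite sum_enum_val.
by apply: eq_bigr => k _; rewrite !mxE.
Qed.

(* With a constant right inverse [B] of one matrix [A], the determinant of
   [gram A B] tests independence without a choice of columns; as only the rows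
   of [A] vary in it, it stays multihomogeneous. *)
Definition gram (K : nzRingType) (A : Rw -> Cl -> K) (B : Cl -> Rw -> K) :=
  \matrix_(i < #|Pr|, j < #|Pr|) \sum_c A (enum_val i) c * B c (enum_val j).

Lemma gramE A B : gram A B =
  mx_of_rows A *m \matrix_(i < #|Cl|, j < #|Pr|) B (enum_val i) (enum_val j).
Proof.
apply/matrixP => i j; rewrite !mxE.
rewrite [LHS](reindex_onto (fun k : 'I_#|Cl| => enum_val k) enum_rank) /=.
  by apply: eq_big => k; rewrite ?enum_valK ?eqxx // !mxE.
by move=> c _; rewrite enum_rankK.
Qed.

Lemma indep_gram A : indep A -> exists B, gram A B = 1%:M.
Proof.
move=> /indepP/row_freeP[B AB].
exists (fun c r => \sum_(j | enum_val j == r) B (enum_rank c) j).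
rewrite gramE -AB; congr (_ *m _); apply/matrixP => i j; rewrite !mxE enum_valK.
by rewrite (big_pred1 j) // => k; rewrite /= (inj_eq enum_val_inj).
Qed.

Lemma gram_indep A B : \det (gram A B) != 0 -> indep A.
Proof.
move=> dAB; apply/indepP; rewrite -row_leq_rank.
have: \rank (gram A B) = #|Pr|.
  by apply/eqP; rewrite -[_ == _]/(row_free _) row_free_unit unitmxE unitfE.
by move=> {1}<-; rewrite gramE mxrankM_maxl.
Qed.

Lemma indep_surj A (rho : Rw -> F) : indep A ->
  exists h : Cl -> F, forall r, Pr r -> \sum_c A r c * h c = rho r.
Proof.
move=> /indep_gram[B AB]; exists (fun c => \sum_(r | Pr r) B c r * rho r) => r Pr_r.
under eq_bigr do rewrite mulr_sumr; rewrite exchange_big (bigD1 r) //=.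
have gE r' : Pr r' -> \sum_c A r c * B c r' = (r == r')%:R.
  move=> Pr_r'; move/matrixP: AB => /(_ (enum_rank_in Pr_r r) (enum_rank_in Pr_r' r')).
  rewrite !mxE !enum_rankK_in // => ->.
  by rewrite -(inj_eq enum_val_inj) !enum_rankK_in.
under eq_bigr do rewrite mulrA; rewrite -mulr_suml gE // eqxx mul1r.
rewrite big1 ?addr0 // => r' /andP[Pr_r' r'r].
under eq_bigr do rewrite mulrA; rewrite -mulr_suml gE //.
by rewrite eq_sym (negPf r'r) mul0r.
Qed.

End Indep.

Lemma gram_map (K L : nzRingType) (f : {rmorphism K -> L}) (Rw Cl : finType)
    (Pr : pred Rw) (A : Rw -> Cl -> K) (B : Cl -> Rw -> K) :
  map_mx f (gram Pr A B) = gram Pr (fun r c => f (A r c)) (fun c r => f (B c r)).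
Proof.
by apply/matrixP => i j; rewrite !mxE rmorph_sum; apply: eq_bigr => c _; rewrite rmorphM.
Qed.

(** The determinant of [gram] is a polynomial in the parameter with value [1] at [0], so it is
    non-zero and has a non-root; the extra factor ['X] keeps that non-root away from [0]. *)
Lemma indep_generic (F : closedFieldType) (Rw Cl : finType) (Pr : pred Rw)
    (A : Rw -> Cl -> {poly F}) :
    indep Pr (fun r c => (A r c).[0]) ->
  exists2 T, T != 0 & indep Pr (fun r c => (A r c).[T]).
Proof.
move=> /indep_gram[B AB]; pose D := gram Pr A (fun c r => (B c r)%:P).
have DE T : (\det D).[T] = \det (gram Pr (fun r c => (A r c).[T]) B).
  rewrite -[LHS]/(horner_eval T _) -det_map_mx gram_map; congr (\det _).
  by apply/matrixP => i j; rewrite !mxE; apply: eq_bigr => c _ /=; rewrite !horner_evalE hornerC.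
have D0 : 'X * \det D != 0.
  rewrite mulf_neq0 ?polyX_eq0 //; apply/eqP => d0.
  by have := DE 0; rewrite d0 AB det1 horner0 => /eqP; rewrite eq_sym oner_eq0.
have [T] := closed_nonrootP _ D0.
rewrite /root hornerM hornerX mulf_eq0 negb_or DE => /andP[T0 dT].
by exists T => //; apply: gram_indep dT.
Qed.

(** * Lattice functions of bounded degree *)

Section Binomial.
Variables (F : fieldType) (K : nat).
Local Notation cell := ('I_K * 'I_K)%type.

Definition binm (bc p : cell) : F := ('C(p.1, bc.1) * 'C(p.2, bc.2))%:R.

(* Functions on the lattice given by polynomials of degree < d, in the binomial
   basis. *)
Definition deg_lt (d : nat) (f : cell -> F) := exists w : cell -> F,
  (forall bc : cell, (d <= bc.1 + bc.2)%N -> w bc = 0) /\ forall p, f p = \sum_bc w bc * binm bc p.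

Lemma deg_lt_le d d' f : (d <= d')%N -> deg_lt d f -> deg_lt d' f.
Proof. by move=> dd [w [w0 fE]]; exists w; split=> // bc h; apply: w0; apply: leq_trans h. Qed.

Lemma deg_lt_add d f g a b : deg_lt d f -> deg_lt d g ->
  deg_lt d (fun p => a * f p + b * g p).
Proof.
move=> [v [v0 fE]] [w [w0 gE]]; exists (fun bc => a * v bc + b * w bc); split.
  by move=> bc h; rewrite v0 // w0 // !mulr0 addr0.
move=> p; rewrite fE gE !mulr_sumr -big_split /=; apply: eq_bigr => bc _.
by rewrite mulrDl !mulrA.
Qed.

Lemma mul_bin_self i b : (i * 'C(i, b) = b.+1 * 'C(i, b.+1) + b * 'C(i, b))%N.
Proof. by rewrite mul_bin_left; case: (leqP b i) => h; [nia | rewrite bin_small //; lia]. Qed.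

(** By [mul_bin_self], a coordinate factor moves coefficients up by at most one place in the
    binomial basis. The hypothesis keeps them below [K], and the factor [b%:R] removes the spurious
    [u b.-1] at [b = 0]. *)
Lemma sum_bin_shift (u : nat -> F) i : u K.-1 = 0 ->
  \sum_(b < K) u b * 'C(i, b)%:R * i%:R =
  \sum_(b < K) b%:R * (u b + u b.-1) * 'C(i, b)%:R.
Proof.
case: K => [|k] /= uk; first by rewrite !big_ord0.
transitivity (\sum_(b < k.+1) u b * (b.+1 * 'C(i, b.+1))%:R +
              \sum_(b < k.+1) b%:R * u b * 'C(i, b)%:R).
  rewrite -big_split /=; apply: eq_bigr => b _.
  rewrite -mulrA -natrM mulnC mul_bin_self natrD mulrDr [b%:R * _]mulrC -!mulrA.
  by rewrite [(b * 'C(i, b))%:R]natrM.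
rewrite big_ord_recr /= uk mul0r addr0 addrC.
transitivity (\sum_(b < k.+1) b%:R * u b * 'C(i, b)%:R +
              \sum_(b < k.+1) b%:R * u b.-1 * 'C(i, b)%:R).
  congr (_ + _); rewrite big_ord_recl /= !mul0r add0r; apply: eq_bigr => b _.
  by rewrite natrM mulrA [_ * u b]mulrC.
by rewrite -big_split /=; apply: eq_bigr => b _; rewrite mulrDr mulrDl.
Qed.

Lemma sum_cell (g : cell -> F) : \sum_p g p = \sum_(b < K) \sum_(c < K) g (b, c).
Proof. by rewrite pair_bigA; apply: eq_bigr => -[]. Qed.

(** Extension by zero, so that coefficients can be taken at plain numbers such as [b.-1]. *)
Let wext (w : cell -> F) (b c : nat) : F :=
  if insub b is Some b' then if insub c is Some c' then w (b', c') else 0 else 0.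

Lemma wextE w (bc : cell) : wext w bc.1 bc.2 = w bc.
Proof. by rewrite /wext !valK; case: bc. Qed.

Lemma deg_lt_mulX d f : (d < K)%N -> deg_lt d f -> deg_lt d.+1 (fun p => p.1%:R * f p).
Proof.
move=> dK [w [w0 fE]].
have w0' b c : (d <= b + c)%N -> wext w b c = 0.
  rewrite /wext; case: insubP => // b' _ <-; case: insubP => // c' _ <- h.
  exact: w0.
exists (fun bc : cell => bc.1%:R * (wext w bc.1 bc.2 + wext w bc.1.-1 bc.2)); split.
  move=> [b c] /= h; case: (val b) h => [|b'] /=; first by rewrite mul0r.
  by move=> h; rewrite !w0' ?addr0 ?mulr0 //; lia.
move=> p; rewrite fE mulr_sumr !sum_cell exchange_big [RHS]exchange_big.
apply: eq_bigr => c _ /=.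
have /(_ p.1) := @sum_bin_shift (fun b => wext w b c) _ (w0' _ _ _) => e.
transitivity ((\sum_(b < K) wext w b c * 'C(p.1, b)%:R * p.1%:R) * 'C(p.2, c)%:R).
  rewrite mulr_suml; apply: eq_bigr => b _; rewrite -(wextE w (b, c)) /binm /= natrM.
  by rewrite mulrC -!mulrA; congr (_ * (_ * _)); rewrite mulrC.
rewrite e; last by lia.
rewrite mulr_suml; apply: eq_bigr => b _; by rewrite /binm /= natrM !mulrA.
Qed.

Lemma deg_lt_mulY d f : (d < K)%N -> deg_lt d f -> deg_lt d.+1 (fun p => p.2%:R * f p).
Proof.
move=> dK [w [w0 fE]].
have swapE (g : cell -> F) : \sum_p g p = \sum_p g (p.2, p.1).
  by rewrite !sum_cell exchange_big.
have : deg_lt d (fun p => f (p.2, p.1)).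
  exists (fun p => w (p.2, p.1)); split=> [[b c] /= h|p]; first by apply: w0; rewrite addnC.
  rewrite fE swapE; apply: eq_bigr => -[b c] _.
  by rewrite /binm /= mulnC.
move=> /(deg_lt_mulX dK)[v [v0 vE]]; exists (fun p => v (p.2, p.1)); split.
  by move=> [b c] /= h; apply: v0; rewrite addnC.
move=> [i j]; have := vE (j, i) => /= ->; rewrite swapE; apply: eq_bigr => -[b c] _.
by rewrite /binm /= mulnC.
Qed.

Definition line (l : F * F * F) (p : cell) : F := l.1.1 + l.1.2 * p.1%:R + l.2 * p.2%:R.

(** Products of lines serve to single out lattice points; this makes them combinations of the jet
    rows. *)
Lemma deg_lt_lines ls : (size ls < K)%N -> deg_lt (size ls).+1 (fun p => \prod_(l <- ls) line l p).
Proof.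
elim: ls => [|l ls IH] /= h.
  have k0 : (0 < K)%N by lia.
  exists (fun bc : cell => (bc == (Ordinal k0, Ordinal k0))%:R); split.
    by move=> bc; case: eqP => // ->.
  move=> p; rewrite big_nil (bigD1 (Ordinal k0, Ordinal k0)) // eqxx mul1r.
  rewrite /binm !bin0 big1; last by move=> i /negPf ->; rewrite mul0r.
  by rewrite /= muln1 addr0.
have {IH}d := IH (ltnW h).
have d1 : deg_lt (size ls).+2 (fun p => \prod_(l <- ls) line l p) by apply: deg_lt_le d.
have dX := deg_lt_mulX h d; have dY := deg_lt_mulY h d.
have [w [w0 wE]] := deg_lt_add 1 1 (deg_lt_add l.1.1 l.1.2 d1 dX) (deg_lt_add l.2 0 dY d1).
exists w; split=> // p; rewrite -wE big_cons /line; ring.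
Qed.

End Binomial.

(** * Sending one point to the boundary of the torus *)

Section Extend.
Variables (F : closedFieldType) (I : finType) (K : nat) (d : I -> nat).
Local Notation cell := ('I_K * 'I_K)%type.
Local Notation row := (I * cell)%type.

(* In characteristic 0, [\sum_p c_p x^p] has multiplicity at least [d] at a point
   [z] of the torus if and only if [\sum_p c_p q(p) z^p = 0] for all polynomials
   [q] of degree < d; row [(a, (b, c))] takes [q] = binomial [(b, c)]. *)
Definition jet (z : I -> F * F) (r : row) (p : cell) : F :=
  binm F r.2 p * (z r.1).1 ^+ p.1 * (z r.1).2 ^+ p.2.

Definition jets_of (l : seq I) : pred row :=
  fun r => (r.1 \in l) && ((r.2.1 + r.2.2 < d r.1)%N).

(** [D] is the set of free lattice points, that is, of the monomials that may still occur. *)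
Definition independent (D : pred cell) (l : seq I) := exists z : I -> F * F,
  (forall a, (z a).1 != 0 /\ (z a).2 != 0) /\
  indep (jets_of l) (fun r p => (D p)%:R * jet z r p).

(* Up to the constant [K], the order in [T] of the monomial [p] at
   [(T^-1, T^K)]. *)
Definition weight (p : cell) := (K * p.2 + (K - p.1))%N.

(** [K - p.1] lies between [1] and [K], so the weights of different rows do not overlap. Hence the
    limit [T = 0] singles out one monomial. *)
Lemma weight_inj p p' : weight p = weight p' -> p = p'.
Proof.
case: p p' => [i j] [i' j']; rewrite /weight /= => e.
have := ltn_ord i; have := ltn_ord i' => hi hi'.
have [jj|jj|/val_inj jj] := ltngtP j j'.
- by have := leq_mul (leqnn K) jj; rewrite mulnS; lia.
- by have := leq_mul (leqnn K) jj; rewrite mulnS; lia.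
- by subst j'; congr (_, _); apply: val_inj => /=; lia.
Qed.

(* [q bc], divided by the power of [T] at [pos bc], becomes the coordinate
   function of [pos bc] at [T = 0]. *)
Lemma independent_cons (D D' : pred cell) a l (pos : cell -> cell) (q : cell -> cell -> F) :
    a \notin l -> {subset D' <= D} ->
    (forall bc : cell, (bc.1 + bc.2 < d a)%N ->
      [/\ D (pos bc), ~~ D' (pos bc), deg_lt (d a) (q bc), q bc (pos bc) != 0 &
       forall p, D p -> q bc p != 0 -> (weight (pos bc) <= weight p)%N]) ->
    {in fun bc : cell => (bc.1 + bc.2 < d a)%N &, injective pos} ->
  independent D' l -> independent D (a :: l).
Proof.
move=> al D'D posP pos_inj [z [z0 iz]].
(* The rows of [a] are written in the functions [q] and divided by their lowest power of [T]; the
   rows of [l] do not depend on [T]. *)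
pose A (r : row) p : {poly F} := if r.1 == a
  then ((D p)%:R * q r.2 p) *: 'X^(weight p - weight (pos r.2))
  else ((D p)%:R * jet z r p)%:P.
have A0a r p : jets_of (a :: l) r -> r.1 = a ->
    (A r p).[0] = (p == pos r.2)%:R * q r.2 p.
  rewrite /jets_of /A => /andP[_ hr] ra; rewrite ra eqxx hornerZ hornerXn expr0n.
  rewrite ra in hr; have [h1 h2 h3 h4 h5] := posP _ hr.
  have [->|/eqP np] := eqVneq p (pos r.2); first by rewrite h1 subnn eqxx mul1r mulr1.
  rewrite mul0r; case Dp: (D p); last by rewrite !mul0r.
  rewrite mul1r; have [->|qp] := eqVneq (q r.2 p) 0; first by rewrite mul0r.
  have := h5 _ Dp qp; case: eqP => [e wl|_ _]; last by rewrite mulr0.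
  by case: np; apply: weight_inj; lia.
have [w wA r|T T0 iT] := @indep_generic F _ _ (jets_of (a :: l)) A.
  (* At [T = 0] the rows of [a] vanish on the columns of [D'], which contain no [pos], so
     independence over [D'] disposes of the rows of [l]. The column at each [pos] then disposes of
     its own row. *)
  have wl r' : jets_of l r' -> w r' = 0.
    apply: iz => p; case D'p: (D' p); last by apply: big1 => r'' _; rewrite !mul0r mulr0.
    rewrite -[RHS](wA p) [RHS](bigID (fun r'' : row => r''.1 == a)) /=.
    rewrite [X in _ = X + _]big1 ?add0r; last first.
      move=> r'' /andP[hr /eqP ra]; rewrite A0a //; case: eqP => [e|]; last first.
        by rewrite mul0r mulr0.
      have [] := posP r''.2; first by move: hr; rewrite /jets_of ra => /andP[].
      by rewrite -e D'p.
    apply: eq_big => [r''|r'' hr].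
      rewrite /jets_of inE; case: eqP => //= [->|_]; last by rewrite andbT.
      by rewrite (negPf al) andbF.
    rewrite /A ifN ?hornerC ?(D'D _ D'p) //.
      by rewrite -[D p]/(p \in D) D'D // mul1r.
    by apply: contraNneq al => <-; case/andP: hr.
  move=> hr; have [ra|ra] := eqVneq r.1 a; last first.
    by apply: wl; move: hr; rewrite /jets_of inE (negPf ra).
  have hr2 : (r.2.1 + r.2.2 < d a)%N by rewrite -ra; case/andP: hr.
  have [_ _ _ q0 _] := posP _ hr2.
  have := wA (pos r.2); rewrite (bigD1 r) //= A0a // eqxx mul1r big1 ?addr0.
    by move/eqP; rewrite mulf_eq0 (negPf q0) orbF => /eqP.
  move=> r' /andP[hr' r'r]; have [ra'|ra'] := eqVneq r'.1 a; last first.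
    by rewrite wl ?mul0r //; move: hr'; rewrite /jets_of inE (negPf ra').
  rewrite A0a //; case: eqP => [e|_]; last by rewrite mul0r mulr0.
  case/eqP: r'r; case: r r' {hr q0} ra ra' hr2 hr' e => [a1 p1] [a2 p2] /= -> -> h1 /andP[_ h2] e.
  by rewrite (pos_inj _ _ h1 h2 e).
pose z' x := if x == a then (T^-1, T ^+ K) else z x.
exists z'; split.
  by move=> x; rewrite /z'; case: ifP => _ //=; rewrite invr_eq0 expf_neq0.
have : forall bc : cell, exists w : cell -> F, (bc.1 + bc.2 < d a)%N ->
    (forall bc : cell, (d a <= bc.1 + bc.2)%N -> w bc = 0) /\
    (forall p, q bc p = \sum_bc w bc * binm F bc p).
  move=> bc; case: (ltnP (bc.1 + bc.2)%N (d a)) => h; last by exists (fun=> 0).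
  by have [_ _ [w hw] _ _] := posP _ h; exists w.
move=> /fin_all_exists[w wP].
(* This matrix expresses the rows of [A] at [T] through the jets at [z']; [T ^+ K] undoes the shift
   by [K] in [weight]. *)
pose G (r r' : row) := if r.1 == a
  then (r'.1 == a)%:R * w r.2 r'.2 * (T ^+ K / T ^+ weight (pos r.2)) else (r == r')%:R.
apply: (indep_mull (G := G)) iT => r p; rewrite /G.
move=> /= hr; have [ra|ra] := eqVneq r.1 a; last first.
  rewrite (bigD1 r) //= eqxx mul1r big1 ?addr0; last first.
    by move=> r' /andP[_ /negPf]; rewrite eq_sym => ->; rewrite mul0r.
  by rewrite /A (negPf ra) hornerC /jet /z' (negPf ra).
have hr2 : (r.2.1 + r.2.2 < d a)%N by rewrite -ra; case/andP: hr.
have [w0 wE] := wP _ hr2.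
rewrite (bigID (fun r' : row => r'.1 == a)) /= [X in _ = _ + X]big1 ?addr0; last first.
  by move=> r' /andP[_ /negPf ->]; rewrite !mul0r.
rewrite (reindex_onto (fun bc : cell => (a, bc)) snd) /=; last first.
  by move=> [a' bc] /andP[_ /eqP /= ->].
rewrite /A ra eqxx hornerZ hornerXn /jet /z' /= eqxx.
have TE : T ^+ weight p = T ^+ K * ((T^-1) ^+ p.1 * (T ^+ K) ^+ p.2).
  rewrite /weight exprD exprM mulrA [RHS]mulrC; congr (_ * _).
  by rewrite exprVn expfB_cond // (negPf T0) add0n ltnW.
transitivity ((D p)%:R * q r.2 p * (T ^+ weight p / T ^+ weight (pos r.2))).
  case Dp: (D p); last by rewrite !mul0r.
  have [->|q0] := eqVneq (q r.2 p) 0; first by rewrite mulr0 !mul0r.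
  by rewrite expfB_cond // (negPf T0) add0n; have [_ _ _ _] := posP _ hr2; apply.
rewrite wE TE mulr_sumr mulr_suml [RHS]big_mkcond; apply: eq_bigr => bc _ /=.
rewrite /jets_of /= inE !eqxx !andbT /=; case: ltnP => h; last by rewrite w0 // mul0r mulr0 mul0r.
move: (D p)%:R (w r.2 bc) (binm F bc p) (T ^+ K ^+ p.2) (T ^+ K) (T^-1 ^+ p.1)
  (T ^+ weight _)^-1 => x1 x2 x3 x4 x5 x6 x7.
ring.
Qed.
End Extend.

(** * Realising the packing by products of lines *)

Section Fill.
Variables (F : closedFieldType) (charF0 : [pchar F] =i pred0).
Variables (I : finType) (K : nat) (d : I -> nat).
Local Notation cell := ('I_K * 'I_K)%type.

Lemma natr_eq (a b : nat) : (a%:R == b%:R :> F) = (a == b).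
Proof.
wlog ab : a b / (a <= b)%N => [hw|].
  by case/orP: (leq_total a b) => /hw //; rewrite eq_sym [RHS]eq_sym.
rewrite -subr_eq0 -opprB oppr_eq0 -natrB // ((pcharf0P F).1 charF0); lia.
Qed.

Definition vline (x : nat) : F * F * F := (- x%:R, 1, 0).
Definition hline (y : nat) : F * F * F := (- y%:R, 0, 1).

Lemma vline_neq0 x (p : cell) : (line (vline x) p != 0) = (p.1 != x :> nat).
Proof. by rewrite /line /= mul1r mul0r addr0 addrC subr_eq0 natr_eq. Qed.

Lemma hline_neq0 y (p : cell) : (line (hline y) p != 0) = (p.2 != y :> nat).
Proof. by rewrite /line /= mul1r mul0r addr0 addrC subr_eq0 natr_eq. Qed.

Lemma lines_neq0 ys xs ls (p : cell) :
  \prod_(l <- map hline ys ++ map vline xs ++ ls) line l p != 0 =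
  [&& nat_of_ord p.2 \notin ys, nat_of_ord p.1 \notin xs & all (fun l => line l p != 0) ls].
Proof.
rewrite prodf_seq_neq0 !all_cat !all_map; congr [&& _, _ & _].
- by elim: ys => //= y s ->; rewrite hline_neq0 inE negb_or.
- by elim: xs => //= y s ->; rewrite vline_neq0 inE negb_or.
Qed.

(** Weight grows with the row and, inside a row, towards the left. Apart from a tip, [(b, c)] is
    sent to the point number [b] from the right in row [c] of the pattern, counting from [0]; [q] is
    a product of fewer than [d a] lines that together contain all free points of smaller weight. *)
Lemma fillable_independent n (l : seq I) : uniq l -> (forall k, n k <= K - k)%N ->
  fillable n (map d l) -> independent F d (fun p : cell => p.1 < n p.2)%N l.
Proof.
elim: l n => [|a l IH] n.
  by move=> _ _ _; exists (fun=> (1, 1)); split=> [_|w _ r]; rewrite ?oner_eq0.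
rewrite [uniq _]/= => /andP[al ul] nK fl.
inversion fl as [|n1 n' s d' ds z0 fit n'E fl' | n1 n' s d' ds z0 ns fit n'E fl']; subst.
- have n'n k : (n' k <= n k)%N by rewrite n'E leq_subr.
  have {IH}ind := IH n' ul _ fl'.
  pose pos (bc : cell) : cell :=
    (insubd bc.1 (n (s + bc.2) - bc.1.+1)%N, insubd bc.2 (s + bc.2)%N).
  have posE (bc : cell) : (bc.1 + bc.2 < d a)%N ->
      (pos bc).1 = (n (s + bc.2) - bc.1.+1)%N :> nat /\ (pos bc).2 = (s + bc.2)%N :> nat.
    move=> h; have := fit bc.2; have := nK (s + bc.2)%N.
    by rewrite /pos /= !val_insubd => h1 h2; rewrite !ifT //; lia.
  pose ls (bc : cell) := map hline (iota s bc.2) ++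
    map vline [seq (n (s + bc.2) - x.+1)%N | x <- iota 0 bc.1] ++ [::].
  apply: (independent_cons (D' := fun p : cell => (p.1 < n' p.2)%N) (pos := pos)
    (q := fun bc p => \prod_(l <- ls bc) line l p)) => //.
  + by move=> p; rewrite /in_mem /= => h; apply: leq_trans (n'n _).
  + move=> bc hbc; have [p1 p2] := posE _ hbc; have := fit bc.2; have := nK (s + bc.2)%N.
    move=> h1 h2; split.
    * by rewrite p1 p2; lia.
    * by rewrite p1 p2 n'E leq_addr; lia.
    * apply: (@deg_lt_le _ _ (size (ls bc)).+1); last apply: deg_lt_lines;
        by rewrite !size_cat !size_map !size_iota /=; lia.
    * rewrite lines_neq0 p1 p2 andbT; apply/andP; split; first by rewrite mem_iota; lia.
      by apply/mapP => -[x]; rewrite mem_iota; lia.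
    * move=> p Dp; rewrite lines_neq0 andbT => /andP[hy hx]; rewrite /weight p1 p2.
      have ps : (s <= p.2)%N by case: leqP => // /z0; lia.
      move: hy; rewrite mem_iota => hy.
      have [e|ne] := eqVneq (nat_of_ord p.2) (s + bc.2)%N; last first.
        have : (s + bc.2 < p.2)%N by lia.
        by move/(leq_mul (leqnn K)); rewrite mulnS; lia.
      move: Dp; rewrite /= e => Dp; rewrite leq_add2l leq_sub2l // leqNgt; apply/negP => hlt.
      move/negP: hx; apply; apply/mapP; exists (n (s + bc.2) - p.1.+1)%N.
        by rewrite mem_iota; lia.
      by lia.
  + move=> bc bc' h h' e; have [p1 p2] := posE _ h; have [p1' p2'] := posE _ h'.
    rewrite e in p1 p2; have e2 : bc.2 = bc'.2 by apply: val_inj => /=; lia.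
    have e1 : bc.1 = bc'.1.
      apply: val_inj => /=; have := fit bc.2; rewrite !unfold_in in h h'.
      by move: p1 p1'; rewrite e2; lia.
    by case: bc bc' e1 e2 {h h' e p1 p2 p1' p2'} => [? ?] [? ?] /= -> ->.
  + by apply: ind => k; apply: leq_trans (nK k).
- have n'n k : (n' k <= n k)%N by rewrite n'E leq_subr.
  have {IH}ind := IH n' ul _ fl'.
  (* The one index with [bc.2 = d a - 1] goes to the tip; the others fill the rows after it. *)
  pose pos (bc : cell) : cell := if (bc.2.+1 < d a)%N then
    (insubd bc.1 (n (s.+1 + bc.2) - bc.1.+1)%N, insubd bc.2 (s.+1 + bc.2)%N)
    else (insubd bc.1 0%N, insubd bc.2 s).
  have posE (bc : cell) : (bc.1 + bc.2 < d a)%N -> (bc.2.+1 < d a)%N ->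
      (pos bc).1 = (n (s.+1 + bc.2) - bc.1.+1)%N :> nat /\ (pos bc).2 = (s.+1 + bc.2)%N :> nat.
    move=> h h0; have := fit bc.2 h0; have := nK (s.+1 + bc.2)%N.
    by rewrite /pos h0 /= !val_insubd => h1 h2; rewrite !ifT //; lia.
  have posE' (bc : cell) : (bc.1 + bc.2 < d a)%N -> ~~ (bc.2.+1 < d a)%N ->
      (pos bc).1 = 0%N :> nat /\ (pos bc).2 = s :> nat.
    move=> h /negPf h0; have := nK s; have := ltn_ord bc.1.
    by rewrite /pos h0 /= !val_insubd => h1 h2; rewrite !ifT //; lia.
  (* The line through the free point of row [s] and the right end of row
     [s.+1 + bc.2]. *)
  pose tip (bc : cell) : F * F * F := let x := (n (s.+1 + bc.2)).-1 in
    ((x * s)%:R, bc.2.+1%:R, - x%:R).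
  have tipE (bc p : cell) : (bc.2.+1 < d a)%N -> (p.2 = s.+1 + bc.2 :> nat)%N ->
      (line (tip bc) p != 0) = (p.1 != (n (s.+1 + bc.2)).-1 :> nat).
    move=> h e; rewrite /line /tip /= e.
    rewrite (_ : _ + _ = bc.2.+1%:R * (p.1%:R - (n (s.+1 + bc.2)%N).-1%:R)); last ring.
    by rewrite mulf_eq0 subr_eq0 natr_eq ((pcharf0P F).1 charF0).
  have tip0 (bc p : cell) : p.1 = 0%N :> nat -> p.2 = s :> nat -> line (tip bc) p = 0.
    by move=> e1 e2; rewrite /line /tip /= e1 e2; ring.
  (* Separate lines for row [s] and for the right end would be one too many when
     [bc.1 + bc.2 = d a - 1]. If [bc.1 > 0], the line [tip] covers both; if [bc.1 = 0], no right end
     has to be covered and row [s] gets its own line. *)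
  pose ls (bc : cell) := if (bc.2.+1 < d a)%N then
      map hline (if bc.1 == 0%N :> nat then iota s bc.2.+1 else iota s.+1 bc.2) ++
      map vline [seq (n (s.+1 + bc.2) - x.+1)%N | x <- iota 1 bc.1.-1] ++
      (if bc.1 == 0%N :> nat then [::] else [:: tip bc])
    else map hline [::] ++ map vline [::] ++ [::].
  apply: (independent_cons (D' := fun p : cell => (p.1 < n' p.2)%N) (pos := pos)
    (q := fun bc p => \prod_(l <- ls bc) line l p)) => //.
  + by move=> p; rewrite /in_mem /= => h; apply: leq_trans (n'n _).
  + move=> bc hbc; rewrite /ls; case: ifPn => hd; last first.
      have [p1 p2] := posE' _ hbc hd; rewrite p1 p2 n'E leqnn eqxx ns; split=> //.
      * apply: (@deg_lt_le _ _ 1); first by lia.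
        by apply: (@deg_lt_lines _ _ [::]) => /=; have := ltn_ord bc.1; lia.
      * by rewrite lines_neq0.
      * move=> p Dp _; rewrite /weight p1 p2.
        have ps : (s <= p.2)%N by case: leqP => // /z0; move: Dp => /=; lia.
        move: ps; rewrite leq_eqVlt => /orP[/eqP e|ps].
          by move: Dp; rewrite /= -e ns; lia.
        by have := leq_mul (leqnn K) ps; rewrite mulnS; lia.
    have [p1 p2] := posE _ hbc hd; have := fit bc.2 hd; have := nK (s.+1 + bc.2)%N.
    move=> h1 h2; split.
    * by rewrite p1 p2; lia.
    * by rewrite p1 p2 n'E ifN ?ifT; lia.
    * set l0 := _ ++ _.
      have : (size l0 < d a)%N.
        by rewrite /l0 !size_cat !size_map; case: eqP => /= e; rewrite !size_iota /=; lia.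
      by move=> hl; apply: (deg_lt_le hl); apply: deg_lt_lines; apply: (leq_trans hl); lia.
    * rewrite lines_neq0 p1 p2; apply/and3P; split.
      - by case: ifP => _; rewrite mem_iota; lia.
      - by apply/mapP => -[x]; rewrite mem_iota; lia.
      - case: ifP => //= b0; rewrite tipE // p1 andbT; move: h1 h2 b0.
        by set N := n _; case: (nat_of_ord bc.1) hbc => [|x] h; lia.
    * move=> p Dp; rewrite lines_neq0 => /and3P[hy hx ht]; rewrite /weight p1 p2.
      have ps : (s <= p.2)%N by case: leqP => // /z0; move: Dp => /=; lia.
      have {}ps : (s.+1 + bc.2 <= p.2)%N.
        have [e|ne] := eqVneq (nat_of_ord p.2) s.
          move: hy ht; case: ifP => _ hy /=; first by move: hy; rewrite mem_iota; lia.
          by rewrite tip0 ?eqxx //; move: Dp; rewrite /= e ns; lia.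
        by move: hy; case: ifP => _; rewrite mem_iota; lia.
      have [e|ne] := eqVneq (nat_of_ord p.2) (s.+1 + bc.2)%N; last first.
        have : (s.+1 + bc.2 < p.2)%N by lia.
        by move/(leq_mul (leqnn K)); rewrite mulnS; lia.
      move: Dp; rewrite /= e => Dp; rewrite leq_add2l leq_sub2l // leqNgt; apply/negP => hlt.
      move: ht; case: ifP => b0 /=; first by lia.
      rewrite tipE // andbT; move: hx hlt Dp; set N := n _ => hx hlt Dp hp.
      move/negP: hx; apply; apply/mapP; exists (N - p.1.+1)%N; last by lia.
      rewrite mem_iota; move: (nat_of_ord p.1) (nat_of_ord bc.1) hp hlt Dp b0 => x y hp hlt Dp b0.
      by lia.
  + move=> bc bc' h h' e; rewrite !unfold_in in h h'.
    have [e1 e2] : bc.1 = bc'.1 :> nat /\ bc.2 = bc'.2 :> nat.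
      case: (boolP (bc.2.+1 < d a)%N) => hd; case: (boolP (bc'.2.+1 < d a)%N) => hd'.
      - have [p1 p2] := posE _ h hd; have [p1' p2'] := posE _ h' hd'.
        rewrite e in p1 p2; have e2 : bc.2 = bc'.2 :> nat by lia.
        by have := fit bc.2 hd; move: p1 p1'; rewrite e2; lia.
      - have [p1 p2] := posE _ h hd; have [p1' p2'] := posE' _ h' hd'.
        by rewrite e in p1 p2; lia.
      - have [p1 p2] := posE' _ h hd; have [p1' p2'] := posE _ h' hd'.
        by rewrite e in p1 p2; lia.
      - by lia.
    by case: bc bc' e1 e2 {h h' e} => [? ?] [? ?] /= /val_inj -> /val_inj ->.
  + by apply: ind => k; apply: leq_trans (nK k).
Qed.
End Fill.

(** * Powers of the ideal of a point *)

Section IdealPowers.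
Variable R : comNzRingType.
Implicit Types (S I : R -> Prop) (x y : R).

Lemma ideal_gen_incl S x : S x -> ideal_gen S x.
Proof. by exists [:: (1, x)]; rewrite ?big_seq1 ?mul1r // => y; rewrite inE => /eqP ->. Qed.

Lemma ideal_gen0 S : ideal_gen S 0.
Proof. by exists [::]; rewrite ?big_nil. Qed.

Lemma ideal_genD S x y : ideal_gen S x -> ideal_gen S y -> ideal_gen S (x + y).
Proof.
move=> [s hs ->] [s' hs' ->]; exists (s ++ s'); last by rewrite big_cat.
by move=> z; rewrite mem_cat => /orP[/hs|/hs'].
Qed.

Lemma ideal_genMl S a x : ideal_gen S x -> ideal_gen S (a * x).
Proof.
move=> [s hs ->]; exists [seq (a * y.1, y.2) | y : R * R <- s].
  by move=> z /mapP[y /hs hy ->].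
by rewrite big_map mulr_sumr; apply: eq_bigr => y _; rewrite mulrA.
Qed.

Lemma ideal_gen_sum S (T : eqType) (s : seq T) (f : T -> R) :
  (forall i, i \in s -> ideal_gen S (f i)) -> ideal_gen S (\sum_(i <- s) f i).
Proof.
elim: s => [|i s IH] h; first by rewrite big_nil; exact: ideal_gen0.
rewrite big_cons; apply: ideal_genD; first by apply: h; rewrite mem_head.
by apply: IH => j js; apply: h; rewrite inE js orbT.
Qed.

(** Surplus factors go into the coefficient. *)
Lemma ideal_pow_prod I d (s : seq R) : (forall x, x \in s -> I x) -> (d <= size s)%N ->
  ideal_pow I d (\prod_(x <- s) x).
Proof.
move=> hs ds; rewrite -(cat_take_drop d s) big_cat /= mulrC; apply: ideal_genMl.
apply: ideal_gen_incl; have hd : size (take d s) == d by rewrite size_takel.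
exists (Tuple hd); last exact: (big_tuple _ _ (Tuple hd)).
by move=> i; apply: hs; apply: (mem_take (n0 := d)); rewrite -[take d s]/(val (Tuple hd)) mem_tnth.
Qed.

End IdealPowers.

(** * Coordinates centred at a point *)

Section Shear.
Variable F : closedFieldType.
Local Notation S := {mpoly F[3]}.
Definition o0 : 'I_3 := ord0.
Definition o1 : 'I_3 := @Ordinal 3 1 isT.
Definition o2 : 'I_3 := ord_max.
Implicit Types (f g : S) (m : 'X_{1..3}).

Lemma I3P (P : 'I_3 -> Prop) : P o0 -> P o1 -> P o2 -> forall i, P i.
Proof.
move=> p0 p1 p2 [[|[|[|i]]] hi] //.
- by rewrite (_ : Ordinal hi = o0) //; apply: val_inj.
- by rewrite (_ : Ordinal hi = o1) //; apply: val_inj.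
- by rewrite (_ : Ordinal hi = o2) //; apply: val_inj.
Qed.

Lemma mdeg3 m : mdeg m = (m o0 + m o1 + m o2)%N.
Proof.
rewrite mdegE !big_ord_recl big_ord0 addn0 addnA.
by congr (_ + m _ + m _)%N; apply: val_inj.
Qed.

Definition mon a b c : 'X_{1..3} := (U_(o0) *+ a + U_(o1) *+ b + U_(o2) *+ c)%MM.

Lemma monE a b c : (mon a b c o0 = a) * (mon a b c o1 = b) * (mon a b c o2 = c).
Proof.
by split; [split|]; rewrite /mon !mnmDE !mulmnE !mnm1E /=; lia.
Qed.

Lemma mon_eta m : m = mon (m o0) (m o1) (m o2).
Proof. by apply/mnmP; apply: I3P; rewrite monE. Qed.

Lemma mon_eq m a b c : (m == mon a b c) = [&& m o0 == a, m o1 == b & m o2 == c].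
Proof.
apply/eqP/and3P => [->|[/eqP <- /eqP <- /eqP <-]]; first by rewrite !monE.
exact: mon_eta.
Qed.

Lemma mdeg_mon a b c : mdeg (mon a b c) = (a + b + c)%N.
Proof. by rewrite mdeg3 !monE. Qed.

Lemma mpolyX_mon a b c : 'X_[mon a b c] = 'X_o0 ^+ a * 'X_o1 ^+ b * 'X_o2 ^+ c :> S.
Proof. by rewrite /mon !mpolyXD !mpolyXn. Qed.

(** A linear change of coordinates that fixes ['X_o2] when [c o2 = 0]; its inverse is then the shear
    by [- c]. *)
Definition shear (c : 'I_3 -> F) f : S := f \mPo [tuple 'X_i + c i *: 'X_o2 | i < 3].

Lemma shearX c i : shear c 'X_i = 'X_i + c i *: 'X_o2.
Proof. by rewrite /shear comp_mpolyXU -tnth_nth tnth_mktuple. Qed.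

Lemma shear_sum c (T : Type) (s : seq T) (h : T -> S) :
  shear c (\sum_(i <- s) h i) = \sum_(i <- s) shear c (h i).
Proof. exact: (raddf_sum (comp_mpoly _)). Qed.

Lemma shearB c : {morph shear c : f g / f - g}.
Proof. exact: comp_mpolyB. Qed.

Lemma shearD c : {morph shear c : f g / f + g}.
Proof. exact: comp_mpolyD. Qed.

Lemma shearM c : {morph shear c : f g / f * g}.
Proof. exact: (rmorphM (comp_mpoly _)). Qed.

Lemma shearXn c k : {morph shear c : f / f ^+ k}.
Proof. exact: (rmorphXn (comp_mpoly _)). Qed.

Lemma shearZ c a f : shear c (a *: f) = a *: shear c f.
Proof. exact: comp_mpolyZ. Qed.

Lemma shearMon c a b e : c o2 = 0 -> shear c 'X_[mon a b e] =
  ('X_o0 + c o0 *: 'X_o2) ^+ a * ('X_o1 + c o1 *: 'X_o2) ^+ b * 'X_o2 ^+ e.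
Proof.
move=> c2; rewrite mpolyX_mon !shearM !shearXn !shearX c2 scale0r addr0 //.
Qed.

Lemma mpolyE_mon f : f = \sum_(m <- msupp f) f@_m *: 'X_[mon (m o0) (m o1) (m o2)].
Proof. by rewrite {1}[f]mpolyE; apply: eq_bigr => m _; rewrite -mon_eta. Qed.

Lemma shearK c f : c o2 = 0 -> shear (fun i => - c i) (shear c f) = f.
Proof.
move=> c2; rewrite {2}[f]mpolyE_mon {1}[f]mpolyE_mon.
rewrite [shear c _]shear_sum shear_sum; apply: eq_bigr => m _.
rewrite !shearZ shearMon // !shearM !shearXn !shearD !shearZ !shearX c2 oppr0 scale0r addr0.
by rewrite !scaleNr !addrNK -mpolyX_mon.
Qed.

Lemma shear_pow (i : 'I_3) (c : F) a : ('X_i + c *: 'X_o2) ^+ a =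
  \sum_(k < a.+1) ('C(a, k)%:R * c ^+ (a - k)) *: ('X_i ^+ k * 'X_o2 ^+ (a - k)) :> S.
Proof.
rewrite addrC exprDn; apply: eq_bigr => k _.
by rewrite exprZn -scalerAl -scaler_nat scalerA mulrC [X in _ *: X]mulrC; congr (_ *: _).
Qed.

Lemma sum_delta a (A : nat -> F) x : ((a < x)%N -> A x = 0) ->
  \sum_(k < a.+1) A k * (nat_of_ord k == x)%:R = A x.
Proof.
move=> h; case: (leqP x a) => xa.
  rewrite (bigD1 (Ordinal (xa : (x < a.+1)%N))) //= eqxx mulr1 big1 ?addr0 // => k kx.
  by rewrite (_ : (k == x :> nat) = false) ?mulr0 //; apply/negbTE.
rewrite h // big1 // => k _.
by rewrite (_ : (k == x :> nat) = false) ?mulr0 //; have := ltn_ord k; lia.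
Qed.

(** Only the first two powers have to be expanded, because the degree fixes the exponent of ['X_o2].
    This is where the binomials in [jet] come from. *)
Lemma mcoeff_shear c a b e m : c o2 = 0 -> mdeg m = (a + b + e)%N ->
  (shear c 'X_[mon a b e])@_m =
  'C(a, m o0)%:R * c o0 ^+ (a - m o0) * ('C(b, m o1)%:R * c o1 ^+ (b - m o1)).
Proof.
move=> c2 dm; rewrite shearMon // !shear_pow big_distrlr /= mulr_suml raddf_sum /=.
have hA : (a < m o0)%N -> 'C(a, m o0)%:R * c o0 ^+ (a - m o0) = 0.
  by move=> h; rewrite bin_small // mul0r.
have hB : (b < m o1)%N -> 'C(b, m o1)%:R * c o1 ^+ (b - m o1) = 0.
  by move=> h; rewrite bin_small // mul0r.
rewrite -(@sum_delta a (fun k => 'C(a, k)%:R * c o0 ^+ (a - k)) _ hA).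
rewrite -(@sum_delta b (fun k => 'C(b, k)%:R * c o1 ^+ (b - k)) _ hB).
rewrite big_distrlr /=; apply: eq_bigr => k _.
rewrite mulr_suml raddf_sum; apply: eq_bigr => l _ /=.
rewrite -scalerAl -scalerAr -!scalerAl !mcoeffZ [RHS]mulrACA mulrA; congr (_ * _).
rewrite [X in X@_m](_ : _ = 'X_[mon k l (a - k + (b - l) + e)]); last first.
  by rewrite mpolyX_mon !exprD; ring.
rewrite mcoeffX eq_sym mon_eq -natrM mulnb; congr (nat_of_bool _)%:R.
rewrite [m o0 == _]eq_sym [m o1 == _]eq_sym andbA; case: eqP => //= ka; case: eqP => //= lb.
by move: dm; rewrite mdeg3; have := ltn_ord k; have := ltn_ord l; lia.
Qed.

Lemma dhomogX1 (i : 'I_3) : ('X_i : S) \is 1.-homog.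
Proof. by rewrite dhomogX; apply/eqP; exact: mdeg1. Qed.

Lemma shear_homog c f k : c o2 = 0 -> f \is k.-homog -> shear c f \is k.-homog.
Proof.
move=> c2 /dhomogP fk; rewrite [f]mpolyE_mon shear_sum big_seq.
apply: rpred_sum => m mf; rewrite shearZ rpredZ // shearMon //.
have -> : k = (1 * m o0 + 1 * m o1 + 1 * m o2)%N by rewrite !mul1n -mdeg3 -(fk _ mf).
have h (i : 'I_3) (a : F) : 'X_i + a *: 'X_o2 \is 1.-homog.
  by rewrite rpredD ?rpredZ ?dhomogX1.
by apply: dhomogM; [apply: dhomogM|]; apply: dhomogMn; rewrite ?dhomogX1.
Qed.

Lemma shear_eval c f (v : 'I_3 -> F) : (shear c f).@[v] = f.@[fun i => v i + c i * v o2].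
Proof.
rewrite comp_mpoly_meval; apply: meval_eq => i.
by rewrite tnth_mktuple mevalD mevalZ !mevalXU.
Qed.

Definition offdeg m := (m o0 + m o1)%N.

(** Membership in the [d]-th power of the ideal generated by ['X_o0] and ['X_o1], the ideal of (0 :
    0 : 1), tested on monomials. *)
Definition ord_ge d f := forall m, m \in msupp f -> (d <= offdeg m)%N.

Lemma ord_geM a b f g : ord_ge a f -> ord_ge b g -> ord_ge (a + b) (f * g).
Proof.
move=> fa gb m /msuppM_le/allpairsP[[m1 m2] /= [/fa h1 /gb h2 ->]].
by rewrite /offdeg !mnmDE; move: h1 h2; rewrite /offdeg; lia.
Qed.

Lemma ord_ge_sum d (T : eqType) (s : seq T) (h : T -> S) :
  (forall i, i \in s -> ord_ge d (h i)) -> ord_ge d (\sum_(i <- s) h i).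
Proof.
elim: s => [|i s IH] hs; first by rewrite big_nil => m; rewrite msupp0.
rewrite big_cons => m /msuppD_le; rewrite mem_cat => /orP[]; first by apply: hs; rewrite mem_head.
by apply: IH => j js; apply: hs; rewrite inE js orbT.
Qed.

Lemma ord_geB d f g : ord_ge d f -> ord_ge d g -> ord_ge d (f - g).
Proof. by move=> fd gd m /msuppB_le; rewrite mem_cat => /orP[/fd|/gd]. Qed.

Lemma ord_ge0 f : ord_ge 0 f.
Proof. by []. Qed.

(** ['X_o2] is a unit at (0 : 0 : 1): multiplying a monomial by it does not change [offdeg]. *)
Lemma ord_ge_X2 d k f : ord_ge d ('X_o2 ^+ k * f) -> ord_ge d f.
Proof.
move=> h m mf; have := h (U_(o2) *+ k + m)%MM.
rewrite mcoeff_msupp mulrC mpolyXn mcoeffMX -mcoeff_msupp => /(_ mf).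
by rewrite /offdeg !mnmDE !mulmnE !mnm1E /=; lia.
Qed.

Section Point.
Variable v : 'rV[F]_3.
Hypothesis v2 : v 0 o2 != 0.

(* [shear slope] moves [v] to (0 : 0 : 1). *)
Definition slope (i : 'I_3) : F := if i == o2 then 0 else v 0 i / v 0 o2.

Lemma slope2 : slope o2 = 0. Proof. by rewrite /slope eqxx. Qed.

(** On the line over (0 : 0 : 1) a form takes the value of its pure ['X_o2] term alone, so vanishing
    there removes that term. *)
Lemma point_ideal_ord f : point_ideal v f -> ord_ge 1 (shear slope f).
Proof.
move=> [s hs ->]; rewrite shear_sum; apply: ord_ge_sum => -[a g] /hs /= [[k gk] gv].
rewrite shearM; apply: (@ord_geM 0 1) => [|m mg]; first exact: ord_ge0.
rewrite lt0n; apply/negP => /eqP m0.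
have /dhomogP hg := shear_homog slope2 gk.
have /eqP : (shear slope g).@[fun i => (i == o2)%:R * v 0 o2] = 0.
  rewrite shear_eval -[RHS]gv; apply: meval_eq; rewrite eqxx mul1r /slope.
  by apply: I3P; rewrite /= ?mul0r ?mul1r ?addr0 ?add0r ?divfK.
rewrite mevalE (bigD1_seq m) ?msupp_uniq //= [X in _ + X]big1_seq; last first.
  move=> m' /andP[m'm m'g]; apply/eqP; rewrite mulf_eq0 prodf_seq_eq0; apply/orP; right.
  have : ~~ ((m' o0 == 0) && (m' o1 == 0))%N.
    apply: contraNN m'm => /andP[/eqP e0 /eqP e1]; apply/eqP/mnmP.
    have : mdeg m' = mdeg m := etrans (hg _ m'g) (esym (hg _ mg)); rewrite !mdeg3 => e.
    by move: m0 e; rewrite /offdeg e0 e1 => m0 e; apply: I3P; lia.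
  rewrite negb_and => /orP[] h; apply/hasP; [exists o0|exists o1]; rewrite ?mem_index_enum //=;
    by rewrite expf_eq0 mul0r eqxx andbT lt0n.
rewrite /= addr0 mulf_eq0 -[_ == 0]negbK -mcoeff_msupp mg /=.
rewrite prodf_seq_eq0 => /hasP[i _] /=; rewrite expf_eq0 mulf_eq0 (negPf v2) orbF.
have [m00 m10] : m o0 = 0%N /\ m o1 = 0%N by move: m0; rewrite /offdeg; lia.
by move: i; apply: I3P; rewrite ?m00 ?m10 // eqxx oner_eq0 andbF.
Qed.

Lemma fat_point_ord d f : ideal_pow (point_ideal v) d f -> ord_ge d (shear slope f).
Proof.
move=> [s hs ->]; rewrite shear_sum; apply: ord_ge_sum => -[a g] /hs /= [u hu ->].
rewrite shearM; apply: (@ord_geM 0 d); first exact: ord_ge0.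
have {hu} : forall x, x \in tval u -> point_ideal v x by move=> x /tnthP[i ->].
rewrite -(big_tuple _ _ u xpredT id) -[X in ord_ge X _](size_tuple u) /=.
elim: (tval u) => [_|x w IH hw]; first by rewrite big_nil.
rewrite big_cons shearM; apply: (@ord_geM 1 (size w)).
  by apply: point_ideal_ord; apply: hw; rewrite mem_head.
by apply: IH => y yw; apply: hw; rewrite inE yw orbT.
Qed.

(** Shearing back turns ['X_o0] and ['X_o1] into linear forms that vanish at [v], and every monomial
    of the sheared polynomial contains at least [d] of these factors. *)
Lemma ord_fat_point d f : ord_ge d (shear slope f) -> ideal_pow (point_ideal v) d f.
Proof.
move=> hf; rewrite -(shearK f slope2); set g := shear slope f.
rewrite [g]mpolyE_mon shear_sum; apply: ideal_gen_sum => m mg.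
rewrite shearZ shearMon ?slope2 ?oppr0 // -mul_mpolyC; apply: ideal_genMl.
rewrite mulrC; apply: ideal_genMl; set g0 := _ + _; set g1 := 'X_o1 + _.
have lin i : i != o2 -> point_ideal v ('X_i + - slope i *: 'X_o2).
  move=> i2; apply: ideal_gen_incl; split.
    by exists 1%N; rewrite rpredD ?rpredZ ?dhomogX1.
  by rewrite mevalD mevalZ !mevalXU /slope (negPf i2) mulNr divfK // subrr.
have -> : g0 ^+ m o0 * g1 ^+ m o1 = \prod_(x <- nseq (m o0) g0 ++ nseq (m o1) g1) x.
  by rewrite big_cat !big_nseq !iter_mulr_1.
apply: ideal_pow_prod; last by rewrite size_cat !size_nseq; exact: hf.
by move=> x; rewrite mem_cat !mem_nseq => /orP[] /andP[_ /eqP ->]; exact: lin.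
Qed.

End Point.

End Shear.

(** * Cech cohomology *)

Section Cech.
Variable F : closedFieldType.
Local Notation S := {mpoly F[3]}.
Implicit Types (f g h q r : S) (i : 'I_3).

Lemma msupp_sumP (Q : 'X_{1..3} -> Prop) (T : eqType) (s : seq T) (P : pred T) (h : T -> S) :
    (forall x, x \in s -> P x -> forall m, m \in msupp (h x) -> Q m) ->
  forall m, m \in msupp (\sum_(x <- s | P x) h x) -> Q m.
Proof.
elim: s => [|x s IH] hs m; first by rewrite big_nil msupp0.
have hs' y : y \in s -> P y -> forall m, m \in msupp (h y) -> Q m.
  by move=> ys; apply: hs; rewrite inE ys orbT.
rewrite big_cons; case: ifP => Px; last exact: IH.
move=> /msuppD_le; rewrite mem_cat => /orP[]; last exact: IH.
by apply: hs; rewrite ?mem_head.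
Qed.

Lemma msupp_Xn i k f m : m \in msupp ('X_i ^+ k * f) -> (k <= m i)%N.
Proof.
rewrite mpolyXn => /msuppM_le/allpairsP[[m1 m2] /= [+ _ ->]].
by rewrite msuppX inE => /eqP ->; rewrite mnmDE mulmnE mnm1E eqxx mul1n leq_addr.
Qed.

(** Monomials are sorted by their exponent at [i]. The remainder consists of monomials of [f], so
    exponent bounds from one division survive the next. *)
Lemma divXn i k f : exists q r, [/\ f = 'X_i ^+ k * q + r,
  forall m, m \in msupp r -> (m i < k)%N && (m \in msupp f) &
  forall e, f \is (e + k).-homog -> q \is e.-homog].
Proof.
exists (\sum_(m <- msupp f | (k <= m i)%N) f@_m *: 'X_[m - U_(i) *+ k]).
exists (\sum_(m <- msupp f | ~~ (k <= m i)%N) f@_m *: 'X_[m]); split.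
- rewrite {1}[f]mpolyE (bigID (fun m : 'X_{1..3} => k <= m i)%N) /=; congr (_ + _).
  rewrite mulr_sumr; apply: eq_bigr => m km.
  rewrite mpolyXn -scalerAr -mpolyXD addmC submK //.
  by apply/mnm_lepP => j; rewrite mulmnE mnm1E; case: eqP => [<-|_]; rewrite ?mul1n.
- apply: msupp_sumP => m mf km m' /msuppZ_le; rewrite msuppX inE => /eqP ->.
  by rewrite ltnNge km.
- move=> e /dhomogP fe; apply/dhomogP; apply: msupp_sumP => m mf km m' /msuppZ_le.
  rewrite msuppX inE => /eqP ->; have : mdeg m = (e + k)%N := fe _ mf.
  rewrite -{1}(@submK _ (U_(i) *+ k)%MM m); last first.
    by apply/mnm_lepP => j; rewrite mulmnE mnm1E; case: eqP => [<-|_]; rewrite ?mul1n.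
  by rewrite mdegD mdegMn mdeg1 mul1n => /addIn.
Qed.

(* This is [H^1(O(t)) = 0], by division of monomials by [X_0^k] and [X_1^k]. *)
Lemma cech_split t k f01 f02 f12 :
    f01 \is (t + k + k).-homog -> f02 \is (t + k + k).-homog ->
    'X_o0 ^+ k * f12 - 'X_o1 ^+ k * f02 + 'X_o2 ^+ k * f01 = 0 ->
  exists g : 'I_3 -> S, [/\ forall i, g i \is (t + k).-homog,
    f01 = 'X_o0 ^+ k * g o1 - 'X_o1 ^+ k * g o0,
    f02 = 'X_o0 ^+ k * g o2 - 'X_o2 ^+ k * g o0 &
    f12 = 'X_o1 ^+ k * g o2 - 'X_o2 ^+ k * g o1].
Proof.
move=> h01 h02 rel.
have X0k : 'X_o0 ^+ k != 0 :> S by rewrite mpolyXn -msupp_eq0 msuppX.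
have [g1 [r [f01E rs g1h]]] := divXn o0 k f01.
have rh : r \is (t + k + k).-homog.
  by apply/dhomogP => m /rs /andP[_]; move/dhomogP: h01; apply.
have [g0 [r' [rE r's g0h]]] := divXn o1 k r.
(* By the relation, ['X_o2 ^+ k * r'] lies in the ideal generated by ['X_o0 ^+ k] and ['X_o1 ^+ k],
   yet its monomials have both exponents below [k]. *)
have r'0 : r' = 0.
  apply/eqP; rewrite -msupp_eq0; case e: (msupp r') => [//|m w].
  have mr' : m \in msupp r' by rewrite e mem_head.
  have /andP[m1 /rs/andP[m0 _]] := r's _ mr'.
  have : ('X_o2 ^+ k * r')@_(U_(o2) *+ k + m) != 0.
    by rewrite mpolyXn mulrC mcoeffMX -mcoeff_msupp.
  have -> : 'X_o2 ^+ k * r' = 'X_o1 ^+ k * (f02 - 'X_o2 ^+ k * g0) -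
      'X_o0 ^+ k * (f12 + 'X_o2 ^+ k * g1).
    apply/eqP; rewrite -subr_eq0 -[X in _ == X]rel f01E rE; apply/eqP; ring.
  rewrite -mcoeff_msupp => /msuppB_le; rewrite mem_cat => /orP[] /msupp_Xn;
    by rewrite mnmDE mulmnE mnm1E /=; lia.
have [g2 [r2 [E2 r2s g2h]]] := divXn o0 k (f02 - 'X_o2 ^+ k * g0).
(* Likewise ['X_o1 ^+ k * r2] is a multiple of ['X_o0 ^+ k], yet its exponents at [o0] are below
   [k]. *)
have r20 : r2 = 0.
  apply/eqP; rewrite -msupp_eq0; case e: (msupp r2) => [//|m w].
  have mr2 : m \in msupp r2 by rewrite e mem_head.
  have /andP[m0 _] := r2s _ mr2.
  have : ('X_o1 ^+ k * r2)@_(U_(o1) *+ k + m) != 0.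
    by rewrite mpolyXn mulrC mcoeffMX -mcoeff_msupp.
  have -> : 'X_o1 ^+ k * r2 = 'X_o0 ^+ k * (f12 + 'X_o2 ^+ k * g1 - 'X_o1 ^+ k * g2).
    have -> : r2 = f02 - 'X_o2 ^+ k * g0 - 'X_o0 ^+ k * g2 by rewrite E2; ring.
    apply/eqP; rewrite -subr_eq0 -oppr_eq0 -[X in _ == X]rel f01E rE r'0; apply/eqP; ring.
  rewrite -mcoeff_msupp => /msupp_Xn.
  by rewrite mnmDE mulmnE mnm1E /=; lia.
exists (fun i => if i == o0 then - g0 else if i == o1 then g1 else g2); split.
- have Xh : ('X_o2 ^+ k : S) \is k.-homog.
    by have := dhomogMn k (dhomogX1 F o2); rewrite mul1n.
  apply: I3P; rewrite /=.
  + by rewrite rpredN g0h.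
  + exact: g1h.
  + apply: g2h; rewrite rpredB // addnC; apply: dhomogM => //; exact: g0h.
- by rewrite f01E rE r'0 /=; ring.
- have -> : f02 = f02 - 'X_o2 ^+ k * g0 + 'X_o2 ^+ k * g0 by ring.
  by rewrite E2 r20 /=; ring.
- apply: (mulfI X0k) => /=; apply/eqP; rewrite -subr_eq0 -[X in _ == X]rel f01E rE r'0.
  have -> : f02 = f02 - 'X_o2 ^+ k * g0 + 'X_o2 ^+ k * g0 by ring.
  by rewrite E2 r20; apply/eqP; ring.
Qed.

End Cech.

Lemma sub_quotients (K : fieldType) (x y a b h : K) : x != 0 -> y != 0 ->
  (b - y * h) / y - (a - x * h) / x = (x * b - y * a) / (x * y).
Proof. by move=> x0 y0; field; rewrite x0 y0. Qed.

(** * From independent jets to the vanishing of the first cohomology *)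

Section Vanishing.
Variables (F : closedFieldType) (n t : nat) (d : 'I_n -> nat).
Local Notation S := {mpoly F[3]}.
Local Notation cell := ('I_t.+1 * 'I_t.+1)%type.

Definition cell_mon (p : cell) := mon p.1 p.2 (t - p.1 - p.2)%N.

(** The homogeneous form of [jet], over any ring so that the coordinates may also be variables. *)
Definition jet_at (R : comNzRingType) (x : 'I_n -> 'I_3 -> R) (r : 'I_n * cell) (p : cell) : R :=
  if (p.1 + p.2 <= t)%N then ('C(p.1, r.2.1) * 'C(p.2, r.2.2))%N%:R *
    (x r.1 o0 ^+ p.1 * x r.1 o1 ^+ p.2 * x r.1 o2 ^+ (t - p.1 - p.2)) else 0.

Variable P : 'M[F]_(n, 3).
Hypothesis P0 : forall a j, P a j != 0.
Hypothesis d_le : forall a, (d a <= t.+1)%N.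
Hypothesis indP : indep (jets_of d (enum 'I_n)) (jet_at P).

Let pt a : 'rV[F]_3 := row a P.
Let pt2 a : pt a 0 o2 != 0. Proof. by rewrite mxE. Qed.
Local Notation sl a := (slope (pt a)).

(** Writing each coordinate as slope times last coordinate turns a row of [jet_at] into Taylor
    coefficients, up to a factor that does not depend on [p]. *)
Lemma shear_jet (r : 'I_n * cell) (p : cell) m : (p.1 + p.2 <= t)%N ->
    mdeg m = t -> m o0 = r.2.1 -> m o1 = r.2.2 ->
  jet_at P r p = (shear (sl r.1) 'X_[cell_mon p])@_m *
    (sl r.1 o0 ^+ r.2.1 * sl r.1 o1 ^+ r.2.2 * P r.1 o2 ^+ t).
Proof.
move=> pt_ dm m0 m1; rewrite mcoeff_shear ?slope2 //; last by rewrite dm; lia.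
rewrite m0 m1 /jet_at pt_.
have sE i : i != o2 -> P r.1 i = sl r.1 i * P r.1 o2.
  by move=> /negPf i2; rewrite /slope i2 !mxE divfK.
case: (leqP r.2.1 p.1) => h0; last by rewrite bin_small // mul0n !mul0r.
case: (leqP r.2.2 p.2) => h1; last by rewrite [in 'C(p.2, _)]bin_small // muln0 !mul0r mulr0 mul0r.
rewrite (sE o0) // (sE o1) // natrM.
move: (sl r.1 o0) (sl r.1 o1) (P r.1 o2) => x y z; rewrite !exprMn.
have -> : z ^+ t = z ^+ p.1 * z ^+ p.2 * z ^+ (t - p.1 - p.2).
  by rewrite -!exprD; congr (_ ^+ _); lia.
have -> : x ^+ p.1 = x ^+ (p.1 - r.2.1) * x ^+ r.2.1 by rewrite -exprD subnK.
have -> : y ^+ p.2 = y ^+ (p.2 - r.2.2) * y ^+ r.2.2 by rewrite -exprD subnK.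
ring.
Qed.

(** Independent jets can be prescribed: [h] is chosen so that ['X_o2 ^+ k * h] has the jets of [g]
    at all points. *)
Lemma interpolation (g : S) k : g \is (t + k).-homog -> exists2 h : S, h \is t.-homog &
  forall a, ord_ge (d a) (shear (sl a) (g - 'X_o2 ^+ k * h)).
Proof.
move=> gh.
pose rho (r : 'I_n * cell) := (shear (sl r.1) g)@_(mon r.2.1 r.2.2 (t + k - r.2.1 - r.2.2)%N) *
  (sl r.1 o0 ^+ r.2.1 * sl r.1 o1 ^+ r.2.2 * P r.1 o2 ^+ t).
have [c cE] := indep_surj rho indP.
pose h : S := \sum_(p : cell) (if (p.1 + p.2 <= t)%N then c p *: 'X_[cell_mon p] else 0).
have hh : h \is t.-homog.
  apply: rpred_sum => p _; case: ifP => pt_; last exact: dhomog0.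
  by rewrite rpredZ // dhomogX; apply/eqP; rewrite -[LHS]/(mdeg _) mdeg_mon; lia.
exists h => // a m mg; rewrite leqNgt; apply/negP => hm.
have gh' : g - 'X_o2 ^+ k * h \is (t + k).-homog.
  rewrite rpredB // addnC; apply: dhomogM => //.
  by have := dhomogMn k (dhomogX1 F o2); rewrite mul1n.
have dm : mdeg m = (t + k)%N.
  by have /dhomogP := shear_homog (slope2 (pt a)) gh'; apply.
have := d_le a; move: hm; rewrite /offdeg => hm da.
have l0 : (m o0 < t.+1)%N by lia.
have l1 : (m o1 < t.+1)%N by lia.
pose r : 'I_n * cell := (a, (Ordinal l0, Ordinal l1)).
have Pr : jets_of d (enum 'I_n) r by rewrite /jets_of /= mem_enum.
pose m' := mon (m o0) (m o1) (t - m o0 - m o1)%N.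
(* [m] has degree [t + k] and [offdeg] at most [t], so ['X_o2 ^+ k] divides it. *)
have mE : m = (U_(o2) *+ k + m')%MM.
  apply/mnmP; move: dm; rewrite mdeg3 => dm.
  by apply: I3P; rewrite mnmDE mulmnE mnm1E monE /=; lia.
have := cE r Pr; rewrite /rho /= -/(sl a).
move: mg; rewrite mcoeff_msupp shearB shearM shearXn shearX slope2 scale0r addr0.
rewrite mcoeffB {2}mE mulrC mpolyXn mcoeffMX.
have -> : mon (m o0) (m o1) (t + k - m o0 - m o1)%N = m.
  by rewrite [RHS]mon_eta; congr mon; move: dm; rewrite mdeg3; lia.
have -> : \sum_p jet_at P r p * c p = (shear (sl a) h)@_m' *
    (sl a o0 ^+ m o0 * sl a o1 ^+ m o1 * P a o2 ^+ t).
  rewrite /h shear_sum raddf_sum mulr_suml; apply: eq_bigr => p _ /=.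
  case: ifP => pt_; last by rewrite /jet_at pt_ mul0r /shear comp_mpoly0 mcoeff0 mul0r.
  rewrite (@shear_jet r p m') ?monE //; last by rewrite mdeg_mon; lia.
  by rewrite shearZ mcoeffZ mulrC mulrA.
move=> ne /mulIf e; case/negP: ne; rewrite subr_eq0; apply/eqP; rewrite -e //.
by rewrite !mulf_neq0 // !expf_neq0 // /slope /= !mxE ?mulf_neq0 ?invr_eq0.
Qed.

Local Notation I := (fat_ideal d P).

Lemma fat_idealP f : I f <-> forall a, ord_ge (d a) (shear (sl a) f).
Proof.
split=> h a; first exact: (fat_point_ord (pt2 a)) (h a).
exact: (ord_fat_point (pt2 a)) (h a).
Qed.

Lemma fat_idealMl g f : I f -> I (g * f).
Proof. by move=> h a; apply: ideal_genMl; exact: h. Qed.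

(** Extending the fraction by powers of [g] lets several sections share one exponent. *)
Lemma section_raise c (g : S) phi : g \is c.-homog -> g != 0 -> section I t c g phi ->
  exists k, forall K, (k <= K)%N -> exists f,
    [/\ I f, f \is (t + K * c).-homog & tofrac f = phi * tofrac g ^+ K].
Proof.
move=> gh g0 [k [f [If fh ->]]]; exists k => K kK.
exists (g ^+ (K - k) * f); split; first exact: fat_idealMl.
  rewrite (_ : t + K * c = c * (K - k) + (t + k * c))%N; last first.
    by rewrite addnCA [(c * _)%N]mulnC -mulnDl subnK.
  by apply: dhomogM => //; apply: dhomogMn.
have gk0 : tofrac g ^+ k != 0 by rewrite expf_neq0 // tofrac_eq0.
rewrite tofracM tofracXn.
have -> : tofrac g ^+ K = tofrac g ^+ (K - k) * tofrac g ^+ k by rewrite -exprD subnK.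
by rewrite [RHS]mulrA [RHS]mulrAC divfK // mulrC.
Qed.

(** The cocycle splits in O(t) as [g]. A form [h] of degree [t] corrects the jets of [g o2] without
    changing the coboundary; the other [g i] are then corrected too, because the cocycle has values
    in the ideal and ['X_o2] is a unit at the points. *)
Lemma h1_vanishing : h1_eq0 I t.
Proof.
move=> s [sec coc].
have X0 i : 'X_i != 0 :> S by rewrite -msupp_eq0 msuppX.
have XX0 i j : 'X_i * 'X_j != 0 :> S by rewrite mulf_neq0.
have XXh i j : ('X_i * 'X_j : S) \is 2.-homog by apply: (@dhomogM _ _ _ 1 _ 1); exact: dhomogX1.
have [k1 r1] := section_raise (XXh _ _) (XX0 _ _) (sec o0 o1).
have [k2 r2] := section_raise (XXh _ _) (XX0 _ _) (sec o0 o2).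
have [k3 r3] := section_raise (XXh _ _) (XX0 _ _) (sec o1 o2).
pose k := (k1 + k2 + k3)%N.
have [|f01 [I01 h01 e01]] := r1 k; first by rewrite /k; lia.
have [|f02 [I02 h02 e02]] := r2 k; first by rewrite /k; lia.
have [|f12 [I12 h12 e12]] := r3 k; first by rewrite /k; lia.
have ek : (t + k * 2 = t + k + k)%N by lia.
rewrite ek in h01 h02.
have rel : 'X_o0 ^+ k * f12 - 'X_o1 ^+ k * f02 + 'X_o2 ^+ k * f01 = 0.
  apply/eqP; rewrite -(tofrac_eq0 (_ + _)) tofracD tofracB !tofracM !tofracXn e01 e02 e12.
  rewrite !tofracM !exprMn; have := coc o0 o1 o2.
  move: (tofrac 'X_o0 ^+ k) (tofrac 'X_o1 ^+ k) (tofrac 'X_o2 ^+ k) => x0 x1 x2 c0.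
  rewrite -[0](mulr0 (x0 * x1 * x2)) -c0; apply/eqP; ring.
have [g [gh g01 g02 g12]] := cech_split h01 h02 rel.
have [h hh hord] := interpolation (gh o2).
have Iu i : I (g i - 'X_i ^+ k * h).
  apply/fat_idealP => a; apply: (@ord_ge_X2 _ _ k).
  have X2E : shear (sl a) 'X_o2 ^+ k = 'X_o2 ^+ k by rewrite shearX slope2 scale0r addr0.
  rewrite -X2E -shearXn -shearM.
  have main f : I f ->
      'X_o2 ^+ k * (g i - 'X_i ^+ k * h) = 'X_i ^+ k * (g o2 - 'X_o2 ^+ k * h) - f ->
      ord_ge (d a) (shear (sl a) ('X_o2 ^+ k * (g i - 'X_i ^+ k * h))).
    move=> /fat_idealP/(_ a) hf ->; rewrite shearB shearM; apply: ord_geB => //.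
    by apply: (@ord_geM _ 0 (d a)); [exact: ord_ge0 | exact: hord].
  move: i main; apply: I3P => main.
  - by apply: (main f02) => //; rewrite g02; ring.
  - by apply: (main f12) => //; rewrite g12; ring.
  - by apply: (main (0 * f12)); [exact: fat_idealMl | ring].
have Xk i : tofrac ('X_i : S) ^+ k != 0 by rewrite expf_neq0 // tofrac_eq0.
pose u i := tofrac (g i - 'X_i ^+ k * h) / tofrac 'X_i ^+ k.
(* The cocycle condition makes [s] alternating, so three entries determine it. *)
have sii i : s i i = 0 by have := coc i i i; rewrite subrr add0r.
have sji i j : s j i = - s i j.
  by have := coc i j i; rewrite sii subr0 => /eqP; rewrite addr_eq0 => /eqP.
exists u.
  move=> i; exists k, (g i - 'X_i ^+ k * h); split=> //; rewrite muln1 rpredB ?gh // addnC.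
  by apply: dhomogM => //; have := dhomogMn k (dhomogX1 F i); rewrite mul1n.
have key i j f : tofrac f = s i j * tofrac ('X_i * 'X_j) ^+ k ->
    f = 'X_i ^+ k * g j - 'X_j ^+ k * g i -> s i j = u j - u i.
  move=> e fE; rewrite fE tofracM exprMn in e.
  rewrite tofracB !tofracM !tofracXn in e.
  rewrite /u !tofracB !tofracM !tofracXn sub_quotients ?Xk // e mulfK //.
  by rewrite mulf_neq0 ?Xk.
have u01 := key _ _ _ e01 g01; have u02 := key _ _ _ e02 g02; have u12 := key _ _ _ e12 g12.
apply: I3P; apply: I3P; rewrite ?sii ?subrr //; by rewrite sji ?u01 ?u02 ?u12 opprB.
Qed.

End Vanishing.

(** * General points *)

Section Multihomogeneous.
Variables (F : closedFieldType) (n : nat).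
Local Notation S := {mpoly F[n * 3]}.
Implicit Types (f g : S) (a b : 'I_n -> nat).

Definition group_deg (m : 'X_{1..n * 3}) (i : 'I_n) := (\sum_(j < 3) m (mxvec_index i j))%N.

(** The condition in [multihomog] with the multidegree exposed, so that multidegrees can be added in
    products. *)
Definition mhomog a f := forall m, m \in msupp f -> forall i, group_deg m i = a i.

Lemma mhomog_ext a b f : a =1 b -> mhomog a f -> mhomog b f.
Proof. by move=> ab fa m /fa h i; rewrite h. Qed.

Lemma mhomogM a b f g : mhomog a f -> mhomog b g -> mhomog (fun i => a i + b i)%N (f * g).
Proof.
move=> fa gb m /msuppM_le/allpairsP[[m1 m2] /= [/fa h1 /gb h2 ->]] i.
rewrite -(h1 i) -(h2 i) /group_deg -big_split; apply: eq_bigr => j _.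
by rewrite mnmDE.
Qed.

Lemma mhomogC (c : F) : mhomog (fun=> 0%N) c%:MP.
Proof.
move=> m; rewrite msuppC; case: eqP => // _; rewrite inE => /eqP -> i.
by rewrite /group_deg big1 // => j _; rewrite mnm0E.
Qed.

Lemma mhomog0 a : mhomog a (0 : S).
Proof. by move=> m; rewrite msupp0. Qed.

Lemma mhomogD a f g : mhomog a f -> mhomog a g -> mhomog a (f + g).
Proof. by move=> fa ga m /msuppD_le; rewrite mem_cat => /orP[/fa|/ga]. Qed.

Lemma mhomog_sum (T : Type) (s : seq T) (P : pred T) (h : T -> S) a :
  (forall x, P x -> mhomog a (h x)) -> mhomog a (\sum_(x <- s | P x) h x).
Proof.
move=> ha; elim/big_rec: _ => [|x f Px]; first exact: mhomog0.
by apply: mhomogD; exact: ha.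
Qed.

Lemma mhomog_prod (T : Type) (s : seq T) (h : T -> S) (a : T -> 'I_n -> nat) :
  (forall x, mhomog (a x) (h x)) ->
  mhomog (fun i => \sum_(x <- s) a x i)%N (\prod_(x <- s) h x).
Proof.
move=> ha; elim: s => [|x s IH].
  rewrite big_nil -mpolyC1.
  by apply: mhomog_ext (@mhomogC 1) => i; rewrite big_nil.
rewrite big_cons; apply: mhomog_ext (mhomogM (ha x) IH) => i; by rewrite big_cons.
Qed.

Lemma mhomogXn a f k : mhomog a f -> mhomog (fun i => k * a i)%N (f ^+ k).
Proof.
move=> fa; elim: k => [|k IH]; first by rewrite expr0 -mpolyC1; exact: mhomogC.
rewrite exprS; apply: mhomog_ext (mhomogM fa IH) => i; by rewrite mulSn.
Qed.

Lemma mxvec_index_inj (i i' : 'I_n) (j j' : 'I_3) :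
  (mxvec_index i j == mxvec_index i' j') = (i == i') && (j == j').
Proof. by rewrite (inj_eq (@cast_ord_inj _ _ _)) (inj_eq enum_rank_inj). Qed.

Lemma mhomog_var (i : 'I_n) (j : 'I_3) :
  mhomog (fun i' => (i == i') : nat) 'X_(mxvec_index i j).
Proof.
move=> m; rewrite msuppX inE => /eqP -> i'; rewrite /group_deg.
under eq_bigr do rewrite mnm1E mxvec_index_inj.
case: (i == i'); last by rewrite big1.
by rewrite (bigD1 j) //= eqxx big1 // => j' /negPf; rewrite eq_sym => ->.
Qed.

(** Each Leibniz term takes one entry from every row, and the multidegree of an entry depends on its
    row only. *)
Lemma mhomog_det k (G : 'M[S]_k) (a : 'I_k -> 'I_n -> nat) :
  (forall i j, mhomog (a i) (G i j)) -> mhomog (fun x => \sum_i a i x)%N (\det G).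
Proof.
move=> hG; apply: mhomog_sum => s _.
have -> : (-1) ^+ perm.odd_perm s = ((-1) ^+ perm.odd_perm s)%:MP :> S.
  by rewrite rmorphXn rmorphN1.
by refine (mhomog_ext _ (mhomogM (@mhomogC _) (mhomog_prod (fun i => hG i _)))).
Qed.

End Multihomogeneous.

Section General.
Variables (F : closedFieldType) (n t : nat) (d : 'I_n -> nat).
Hypothesis d_le : forall a, (d a <= t.+1)%N.

Lemma jet_at_map (R R' : comNzRingType) (f : {rmorphism R -> R'}) x r p :
  f (@jet_at n t R x r p) = jet_at (fun a j => f (x a j)) r p.
Proof.
rewrite /jet_at; case: ifP => _; last exact: rmorph0.
by rewrite rmorphM rmorph_nat !rmorphM !rmorphXn.
Qed.

(** One polynomial defines the open set: the determinant of [gram] at variable points times all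
    coordinates. At [P0] the determinant is [1], so the set is non-empty. *)
Lemma general_vanishing (P0 : 'M[F]_(n, 3)) : (forall a j, P0 a j != 0) ->
    indep (jets_of d (enum 'I_n)) (@jet_at n t F P0) ->
  for_general_points (fun P : 'M[F]_(n, 3) => h1_eq0 (fat_ideal d P) t).
Proof.
move=> P0nz /indep_gram[B gB].
pose xvar (a : 'I_n) (j : 'I_3) : {mpoly F[n * 3]} := 'X_(mxvec_index a j).
pose G := gram (jets_of d (enum 'I_n)) (jet_at xvar) (fun c r => (B c r)%:MP).
pose Q := \det G * \prod_a \prod_j xvar a j.
have evar (P : 'M[F]_(n, 3)) a j : (xvar a j).@[fun k => mxvec P 0 k] = P a j.
  by rewrite mevalXU mxvecE.
have QE (P : 'M[F]_(n, 3)) : eval_points Q P =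
    \det (gram (jets_of d (enum 'I_n)) (jet_at P) B) * \prod_a \prod_j P a j.
  rewrite /eval_points mevalM -det_map_mx gram_map; congr (\det _ * _).
    apply/matrixP => i j; rewrite !mxE; apply: eq_bigr => c _.
    rewrite /= mevalC jet_at_map; congr (_ * _); rewrite /jet_at.
    by rewrite /= !evar.
  rewrite rmorph_prod; apply: eq_bigr => a _; rewrite rmorph_prod.
  by apply: eq_bigr => j _; exact: evar.
have Qh : multihomog Q.
  eexists; apply: mhomogM; last first.
    by apply: mhomog_prod => a; apply: mhomog_prod => j; exact: mhomog_var.
  (* As [B] is constant, a row of [G] has degree [t] in the coordinates of its own point and degree
     [0] in the others. *)
  apply: (mhomog_det (a := fun k i => (t * ((enum_val k).1 == i))%N)) => k l; rewrite mxE.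
  apply: mhomog_sum => p _.
  have h : mhomog (fun i => t * ((enum_val k).1 == i))%N (jet_at xvar (enum_val k) p).
    rewrite /jet_at; case: ifP => pt_; last exact: mhomog0.
    rewrite -mpolyC_nat; refine (mhomog_ext _ (mhomogM (@mhomogC _ _ _)
      (mhomogM (mhomogM (mhomogXn (@mhomog_var _ _ _ _)) (mhomogXn (@mhomog_var _ _ _ _)))
         (mhomogXn (@mhomog_var _ _ _ _))))) => i /=.
    by rewrite -!mulnDl; congr (_ * _)%N; lia.
  by refine (mhomog_ext _ (mhomogM h (@mhomogC _ _ _))) => i; rewrite addn0.
exists (fun P => eval_points Q P != 0); split.
- exists (fun f => f = Q) => [f -> //|P _]; split; first by exists Q.
  by move=> [f ->].
- exists P0.
    move=> i; apply/eqP => /rowP/(_ ord0); rewrite !mxE => /eqP.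
    by rewrite (negPf (P0nz _ _)).
  rewrite QE gB det1 mul1r; apply/prodf_neq0 => a _; apply/prodf_neq0 => j _; exact: P0nz.
- move=> P _; rewrite QE mulf_eq0 negb_or => /andP[dP /prodf_neq0 nzP].
  apply: h1_vanishing => //; last exact: gram_indep dP.
  by move=> a j; have /prodf_neq0 := nzP a isT; apply.
Qed.

End General.

(** * Combining the packing with openness *)

Local Open Scope nat_scope.

Lemma perm_split_mult (s : seq nat) : all (leq 1) s ->
  perm_eq s ([seq x <- s | 2 < x] ++ nseq (count_mem 2 s) 2 ++ nseq (count_mem 1 s) 1).
Proof.
move=> s0; apply/permP => a; rewrite !count_cat !count_nseq.
elim: s s0 => [|x s IH]; first by rewrite /= !muln0.
rewrite [all _ _]/= => /andP[x0 /IH {}IH].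
by rewrite /= IH; case: x x0 => [|[|[|x]]] //= _; lia.
Qed.

(** Carries the order of multiplicities found by the packing over to the points themselves. *)
Lemma perm_map_lift (T : eqType) (U : eqType) (f : T -> U) (s : seq T) (us : seq U) :
  perm_eq us (map f s) -> exists2 s', perm_eq s' s & map f s' = us.
Proof.
elim: us s => [|u us IH] s p.
  by exists [::] => //; move: p; case: s => // x s /perm_size.
have : u \in map f s by rewrite -(perm_mem p) mem_head.
move=> /mapP[x xs uE]; have ps := perm_to_rem xs.
have : perm_eq us (map f (rem x s)).
  by rewrite -(perm_cons u) (perm_trans p) // uE -map_cons perm_map.
move=> /IH[s' p' e]; exists (x :: s'); last by rewrite /= e uE.
by rewrite perm_sym (perm_trans ps) // perm_cons perm_sym.
Qed.

Lemma independent_mults (F : closedFieldType) (charF0 : [pchar F]%R =i pred0) (t m : nat)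
    (I : finType) (d : I -> nat) :
    1 < m -> (forall a, 0 < d a <= m) ->
    1 + \sum_a tri (d a) <= tri t.+1 ->
    (m - 1) * (t - 1) <= 2 * count_mem 2 (map d (enum I)) ->
  independent F (K := t.+1) d (fun p => p.1 + p.2 <= t) (enum I).
Proof.
move=> m1 dm hs he; set s := map d (enum I) in he *.
have s1 : all (leq 1) s by apply/allP => _ /mapP[a _ ->]; case/andP: (dm a).
have ps := perm_split_mult s1; set bs := filter _ _ in ps.
have St0 : steady t m 0 (fun=> 0) by split=> // *; rewrite !muln0.
have ar : tri t.+1 <= area t (fun=> 0).
  have := sum_flat t.+1 0 t.+1; rewrite subn0 subnn /= => <-; rewrite addn0.
  by apply: leq_sum => i _; rewrite /room; lia.
have [||| ds pds fds] := @fill_all t m 0 (fun=> 0) bs (count_mem 2 s) (count_mem 1 s) m1 St0.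
- apply/allP => x; rewrite mem_filter => /andP[-> /mapP[a _ ->]] /=.
  by case/andP: (dm a).
(* At [s = 0] the summand [(m - 1) * 1] absorbs [minn], which leaves the bound on the number of
   double points. *)
- by have := geq_minr (room t (fun=> 0) 0) (m - 1); lia.
- apply: leq_trans ar; apply: leq_trans hs.
  have -> : \sum_a tri (d a) = sumn (map tri s).
    by rewrite /s -map_comp sumnE big_map big_enum.
  have := perm_sumn (perm_map tri ps); rewrite !map_cat !map_nseq !sumn_cat !sumn_nseq => ->.
  by rewrite (_ : tri 2 = 3) // (_ : tri 1 = 1) // mul1n !addnA.
have := perm_trans pds (eqbRL (perm_sym _ _) ps).
move=> /perm_map_lift[l pl lE].
have ul : uniq l by rewrite (perm_uniq pl) enum_uniq.
rewrite -lE in fds.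
have nK k : room t (fun=> 0) k <= t.+1 - k by rewrite /room subn0.
have [z [z0 iz]] := fillable_independent charF0 ul nK fds.
exists z; split=> // w wA r; rewrite /jets_of -(perm_mem pl); apply: iz => p.
rewrite -[RHS](wA p); apply: eq_big => [r'|r' _].
  by rewrite /jets_of (perm_mem pl).
congr (_ * (_%:R * _))%R; congr nat_of_bool; rewrite /room; apply/idP/idP; lia.
Qed.

(** Only an inequality, as some of the [d i] may equal [2] as well. *)
Lemma count_doubles r e (d : 'I_r -> nat) :
  e <= count_mem 2 (map (mult_seq e d) (enum 'I_(r + e))).
Proof.
rewrite count_map -sum1_count big_enum_cond big_mkcond big_split_ord /=.
apply: leq_trans (leq_addl _ _).
rewrite -[leqLHS]card_ord -sum1_card; apply: leq_sum => i _.
by rewrite /mult_seq -[rshift r i]/(unsplit (inr i)) unsplitK.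
Qed.

Theorem theorem0p1 (F : closedFieldType) (charF0 : [pchar F]%R =i pred0)
    (t r e : nat) (d : 'I_r -> nat)
    (t_gt0 : 0 < t) (r_gt0 : 0 < r) (e_gt0 : 0 < e)
    (d_gt0 : forall i, 0 < d i)
    (m := \max_(j < r + e) mult_seq e d j)
    (Hlen : 1 + \sum_(j < r + e) (mult_seq e d j * (mult_seq e d j + 1)) %/ 2
            <= ((t + 2) * (t + 1)) %/ 2)
    (He : (m - 1) * (t - 1) <= 2 * e) :
  for_general_points (fun P : 'M[F]_(r + e, 3) =>
    distinct_points P -> h1_eq0 (fat_ideal (mult_seq e d) P) t).
Proof.
set dd := mult_seq e d in Hlen *.
have dd0 j : 0 < dd j by rewrite /dd /mult_seq; case: split.
have ddm j : dd j <= m by apply: (leq_bigmax (F := dd)).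
have m1 : 1 < m.
  have := ddm (rshift r (Ordinal e_gt0)).
  by rewrite /dd /mult_seq -[rshift _ _]/(unsplit (inr _)) unsplitK.
have hs : 1 + \sum_j tri (dd j) <= tri t.+1.
  by apply: leq_trans Hlen _; rewrite /tri !addn1 addn2 [t.+2 * _]mulnC.
have d_le a : dd a <= t.+1.
  have : tri (dd a) <= tri t.+1.
    by apply: leq_trans hs; rewrite (bigD1 a) //=; lia.
  by have := double_tri (dd a); have := double_tri t.+1; nia.
have [||z [z0 iz]] := @independent_mults F charF0 t m _ dd m1 _ hs.
- by move=> a; rewrite dd0 ddm.
- by apply: leq_trans He _; rewrite leq_mul2l count_doubles.
(* The torus point [z a] becomes the point of the plane with last coordinate [1]. *)
pose P0 : 'M[F]_(r + e, 3) :=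
  (\matrix_(a, j) (if j == o0 then (z a).1 else if j == o1 then (z a).2 else 1))%R.
have P0nz a j : (P0 a j != 0)%R.
  have [z1 z2] := z0 a; rewrite mxE; case: ifP => // _; case: ifP => // _.
  exact: oner_neq0.
have indP0 : indep (jets_of dd (enum 'I_(r + e))) (@jet_at _ t F P0).
  move=> w wA; apply: iz => p; rewrite -[RHS](wA p); apply: eq_bigr => x _.
  rewrite /jet_at /jet !mxE /= expr1n mulr1 /binm; case: ifP => _.
    by rewrite mul1r -mulrA.
  by rewrite mul0r.
have [U [oU [Q pQ UQ] hU]] := general_vanishing d_le P0nz indP0.
exists U; split=> //; first by exists Q.
by move=> P pP UP _; exact: hU.
Qed.
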